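(* Let $\beta>0$ and let $\xi$ be a positive random variable such that $$-\log P[\xi>t]\sim c\,t^{\beta}\quad\text{as } t\to\infty$$ for some constant $c>0$. Let $Y$ be a one-dimensional Brownian motion started at $0$, independent of $\xi$, and let $\eta_{(-\xi,\xi)}=\inf\{t\ge0: Y_t\notin(-\xi,\xi)\}$. Then, as $t\to\infty$, $$-\log P[\eta_{(-\xi,\xi)}>t]\sim 2^{-\frac{2\beta}{2+\beta}}\Big(\frac{2+\beta}{2}\Big)c^{2/(2+\beta)}\beta^{-\beta/(2+\beta)}\pi^{2\beta/(2+\beta)}\,t^{\beta/(2+\beta)}.$$
   Context: $f(t)\sim g(t)$ as $t\to\infty$ means $f(t)/g(t)\to1$. *)

(* Defs.v *)
From HB Require Import structures.
From mathcomp Require Import all_boot all_order all_algebra.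
From mathcomp Require Import all_classical all_reals all_analysis.
Set Implicit Arguments. Unset Strict Implicit. Unset Printing Implicit Defensive.
Import Order.TTheory GRing.Theory Num.Theory.
Import numFieldNormedType.Exports.
Local Open Scope classical_set_scope.
Local Open Scope ring_scope.

Definition asymp_equiv {R : realType} (f g : R -> R) : Prop :=
  (fun t => f t / g t) @ +oo --> (1 : R).

Definition mutually_independent_rvs {R : realType} (d : measure_display)
  (T : measurableType d) (P : probability T R) (n : nat)
  (X : 'I_n -> T -> R) : Prop :=
  forall B : 'I_n -> set R, (forall i, measurable (B i)) ->
    P (\bigcap_(i in [set: 'I_n]) (X i @^-1` B i)) =
    (\prod_(i < n) P (X i @^-1` B i))%E.

Definition brownian_motion {R : realType} (d : measure_display)
  (T : measurableType d) (P : probability T R) (Y : R -> T -> R) : Prop :=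
  [/\ (forall w, Y 0 w = 0),
      (forall w, {within [set t : R | 0 <= t], continuous (fun t => Y t w)}),
      (forall t, 0 <= t -> measurable_fun [set: T] (Y t)),
      (forall (n : nat) (s : nat -> R), 0 <= s 0%N ->
          (forall i, (i < n)%N -> s i < s i.+1) ->
          mutually_independent_rvs P
            (fun (i : 'I_n) w => Y (s i.+1) w - Y (s i) w)) &
      (forall s t, 0 <= s -> s < t -> forall B, measurable B ->
          P ((fun w => Y t w - Y s w) @^-1` B) =
          normal_prob 0 (Num.sqrt (t - s)) B)].

Definition sigma_process {R : realType} (d : measure_display)
  (T : measurableType d) (Y : R -> T -> R) : set (set T) :=
  <<s [set: T], \bigcup_(t in [set t : R | 0 <= t])
                   [set Y t @^-1` B | B in (measurable : set (set R))] >>.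

Definition sigma_rv {R : realType} (d : measure_display)
  (T : measurableType d) (X : T -> R) : set (set T) :=
  [set X @^-1` B | B in (measurable : set (set R))].

Definition independent_sigma {R : realType} (d : measure_display)
  (T : measurableType d) (P : probability T R) (F G : set (set T)) : Prop :=
  forall A B, F A -> G B -> P (A `&` B) = (P A * P B)%E.

(* exit time of Y from the (random) interval (-xi, xi):
   inf {t >= 0 : Y_t not in (-xi, xi)}, valued in \bar R (inf of empty = +oo) *)
Definition exit_time {R : realType} (T : Type) (Y : R -> T -> R) (xi : T -> R)
  (w : T) : \bar R :=
  ereal_inf [set s%:E | s in [set s : R | 0 <= s /\ ~ (- xi w < Y s w < xi w)]].

(* Main.v *)
(** For a Gaussian walk [S] with step variance [delta], put
    [m n = E[cos (a * S n); |S k| <= rho for all k <= n]]. Independence of the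
    next step gives [E[cos (a * S n.+1); |S k| <= rho for k <= n] = h * m n] with
    [h = exp (- a ^ 2 * delta / 2) + O(delta ^ 2)], and discarding the paths that
    leave at step [n.+1] only helps (or only hurts) up to a jump probability
    [O(delta ^ 2)], provided [a * rho] is [pi / 2] (or slightly less). Letting
    [delta] tend to [0] at fixed [t = n * delta] yields
    [exp (- pi ^ 2 * t / (8 * r ^ 2)) <= P(|Y| <= r on [0, t])] together with a
    matching upper bound in which [pi] is replaced by [kappa * pi], [kappa < 1],
    at the price of a constant.

    Conditioning on the value [r = x * t ^ (1 / (2 + beta))] of [xi] then costs
    [(c * x ^ beta + pi ^ 2 / (8 * x ^ 2)) * t ^ (beta / (2 + beta))] in the
    exponent. The optimal [x] gives the lower bound, a union bound over a finite
    geometric grid of values of [x] the upper bound. *)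
Require Import Defs.
From HB Require Import structures.
From mathcomp Require Import all_boot all_order all_algebra.
From mathcomp Require Import all_classical all_reals all_analysis.
From mathcomp Require Import measurable_realfun.
From mathcomp Require Import ring lra.
Import Order.TTheory GRing.Theory Num.Theory.
Import numFieldNormedType.Exports.
Local Open Scope classical_set_scope.
Local Open Scope ring_scope.

(** * Hyperbolic bounds on the cosine *)

Definition ch {R : realType} (u : R) : R := (expR u + expR (- u)) / 2.
Definition sh {R : realType} (u : R) : R := (expR u - expR (- u)) / 2.

Section hyperbolic.
Context {R : realType}.
Implicit Types u v x : R.

Lemma is_derive_expRN u : is_derive u 1 (fun u : R => expR (- u)) (- expR (- u)).
Proof.
rewrite -mulrN1 -[fun _ => _]/(expR \o -%R).
apply: is_derive1_comp.
Qed.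

#[local] Instance is_derive_ch u : is_derive u 1 (@ch R) (sh u).
Proof.
have h := is_derive_expRN u.
rewrite (_ : ch = (fun u : R => 2^-1 *: (expR u + expR (- u)))).
  by apply: is_derive_eq; rewrite /sh /GRing.scale/= mulrC.
by apply/funext => x; rewrite /ch mulrC.
Qed.

#[local] Instance is_derive_sh u : is_derive u 1 (@sh R) (ch u).
Proof.
have h := is_derive_expRN u.
rewrite (_ : sh = (fun u : R => 2^-1 *: (expR u - expR (- u)))).
  by apply: is_derive_eq; rewrite /ch /GRing.scale/= opprK mulrC.
by apply/funext => x; rewrite /sh mulrC.
Qed.

Lemma ch0 : ch (0 : R) = 1.
Proof. by rewrite /ch oppr0 expR0 -[1 + 1]/(2) divff. Qed.

Lemma sh0 : sh (0 : R) = 0.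
Proof. by rewrite /sh oppr0 subrr mul0r. Qed.

Lemma chN u : ch (- u) = ch u.
Proof. by rewrite /ch opprK addrC. Qed.

Lemma ch_abs u : ch `|u| = ch u.
Proof. by have [u0|u0] := leP 0 u; rewrite ?(ger0_norm u0) ?(ltr0_norm u0) ?chN. Qed.

Lemma ch_gt0 u : 0 < ch u.
Proof. by rewrite divr_gt0// addr_gt0// expR_gt0. Qed.

(** Mean value theorem. The inequalities on the half-line below come from differentiating repeatedly
    until the sign is evident, with the values at [0] checked at each stage. *)
Lemma ge0_of_derive_ge0 (f df : R -> R) {x} :
  0 <= x -> (forall x, is_derive x 1 f (df x)) -> 0 <= f 0 ->
  (forall x, 0 <= x -> 0 <= df x) -> 0 <= f x.
Proof.
rewrite le_eqVlt => /predU1P[<-//|x0] fE f0 df0.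
have [|c cx fx] := MVT x0 (fun z _ => fE z).
  by apply: derivable_within_continuous => z _; have [] := fE z.
have c0 : 0 <= c by move: cx; rewrite in_itv/= => /andP[/ltW].
have := mulr_ge0 (df0 c c0) (ltW x0); rewrite -[X in _ * X]subr0 -fx; lra.
Qed.

Lemma sh_ge0 u : 0 <= u -> 0 <= sh u.
Proof.
move=> u0; apply: (ge0_of_derive_ge0 sh ch u0) => [|x _]; first by rewrite sh0.
exact/ltW/ch_gt0.
Qed.

Lemma ch_ge1Dsqr u : 1 + u ^+ 2 / 2 <= ch u.
Proof.
wlog u0 : u / 0 <= u.
  move=> hu; rewrite -ch_abs -(real_normK (num_real u)); exact/hu/normr_ge0.
have ch1 x : 0 <= x -> 0 <= ch x - 1.
  move=> x0; apply: (ge0_of_derive_ge0 (fun x => ch x - 1) sh x0) => [y||].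
  + by apply: is_derive_eq; rewrite subr0.
  + by rewrite ch0 subrr.
  + exact: sh_ge0.
have sh_ge x : 0 <= x -> 0 <= sh x - x.
  move=> x0.
  apply: (ge0_of_derive_ge0 (fun x => sh x - x) (fun x => ch x - 1) x0) => //.
  by rewrite sh0 subrr.
suff : 0 <= ch u - 1 - u ^+ 2 / 2 by lra.
apply: (ge0_of_derive_ge0 (fun x => ch x - 1 - x ^+ 2 / 2) (fun x => sh x - x) u0) => //.
- move=> x; apply: is_derive_eq.
  by rewrite /= /GRing.scale/=; lra.
- by rewrite ch0; lra.
Qed.

Lemma ch_ge1 u : 1 <= ch u.
Proof. by apply: le_trans (ch_ge1Dsqr u); rewrite lerDl divr_ge0// sqr_ge0. Qed.

Lemma sin_le_sh u : 0 <= u -> 0 <= sh u - sin u.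
Proof.
move=> u0; apply: (ge0_of_derive_ge0
  (fun u => sh u - sin u) (fun u => ch u - cos u) u0) => [|x _].
- by rewrite sh0 sin0 subrr.
- by rewrite subr_ge0 (le_trans (cos_le1 _))// ch_ge1.
Qed.

(* The Gaussian expectations of [ch u] and [(ch u - 1) ^ 2] are explicit from
   the moment generating function, and the gap between the two bounds is of
   order [u ^ 4]; this replaces the Gaussian characteristic function. *)
Lemma cos_ge_ch u : 2 - ch u <= cos u.
Proof.
wlog u0 : u / 0 <= u.
  by move=> hu; rewrite -ch_abs -cos_norm; exact/hu/normr_ge0.
suff : 0 <= ch u + cos u - 2 by lra.
apply: (ge0_of_derive_ge0
  (fun u => ch u + cos u - 2) (fun u => sh u - sin u) u0) => [x||x].
- by apply: is_derive_eq; rewrite subr0.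
- by rewrite ch0 cos0; lra.
- exact: sin_le_sh.
Qed.

Lemma cos_le_ch u : cos u <= 2 - ch u + (ch u - 1) ^+ 2.
Proof.
wlog u0 : u / 0 <= u.
  by move=> hu; rewrite -ch_abs -cos_norm; exact/hu/normr_ge0.
(* Third derivative of the difference of the two sides, nonnegative because [8 * ch x - 3 >= 1] and
   [sin x <= sh x]. Each lower derivative vanishes at [0]. *)
have d3 x : 0 <= x -> 0 <= sh x * (8 * ch x - 3) - sin x.
  move=> x0; have := sin_le_sh x x0; have := sh_ge0 x x0; have := ch_ge1 x.
  by nra.
have d2 x : 0 <= x -> 0 <= 2 * sh x ^+ 2 + 2 * (ch x - 1) * ch x - ch x + cos x.
  move=> x0; apply: (ge0_of_derive_ge0
    (fun x => 2 * sh x ^+ 2 + 2 * (ch x - 1) * ch x - ch x + cos x)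
    (fun x => sh x * (8 * ch x - 3) - sin x) x0) => [y||//].
  + by apply: is_derive_eq; rewrite /= /GRing.scale/=; ring.
  + by rewrite ch0 sh0 cos0 /GRing.scale/=; lra.
have d1 x : 0 <= x -> 0 <= 2 * (ch x - 1) * sh x - sh x + sin x.
  move=> x0; apply: (ge0_of_derive_ge0
    (fun x => 2 * (ch x - 1) * sh x - sh x + sin x) _ x0 _ _ d2) => [y|].
  + by apply: is_derive_eq; rewrite /= /GRing.scale/=; ring.
  + by rewrite ch0 sh0 sin0 /GRing.scale/=; lra.
suff : 0 <= (ch u - 1) ^+ 2 - ch u - cos u + 2 by lra.
apply: (ge0_of_derive_ge0
  (fun x => (ch x - 1) ^+ 2 - ch x - cos x + 2) _ u0 _ _ d1) => [y|].
- by apply: is_derive_eq; rewrite /= /GRing.scale/=; ring.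
- by rewrite ch0 cos0; lra.
Qed.

End hyperbolic.

(** * Gaussian expectations *)

Lemma integrable_le1 {d} {T : measurableType d} {R : realType}
  (P : probability T R) (f : T -> R) : measurable_fun setT f ->
  (forall w, `|f w| <= 1) -> P.-integrable setT (EFin \o f).
Proof.
move=> mf f1; apply: measurable_bounded_integrable => //.
  exact: fin_num_fun_lty.
exists 1; split; first exact: num_real.
by move=> M M1 w _ /=; apply: le_trans (f1 w) (ltW M1).
Qed.

(** * Integration against a density *)

Section density.
Local Open Scope ereal_scope.
Context {d} {T : measurableType d} {R : realType}.
Variables (mu nu : {measure set T -> \bar R}) (g : T -> R).
Hypotheses (mg : measurable_fun [set: T] g) (g0 : forall x, (0 <= g x)%R).
Hypothesis nuE : forall A, measurable A -> nu A = \int[mu]_(x in A) (g x)%:E.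

Import HBNNSimple.

(** The density formula for sets gives it for indicators, hence for simple functions, and monotone
    convergence along [nnsfun_approx] does the rest. *)
Lemma ge0_integral_density (f : T -> \bar R) :
  measurable_fun [set: T] f -> (forall x, 0 <= f x) ->
  \int[nu]_x f x = \int[mu]_x (f x * (g x)%:E).
Proof.
move=> mf f0.
have mg' : measurable_fun [set: T] (fun x => (g x)%:E) by exact/measurable_EFinP.
pose h := nnsfun_approx measurableT mf.
have hf x : (h n x)%:E @[n --> \oo] --> f x by exact: cvg_nnsfun_approx.
have -> : \int[nu]_x f x = lim (\int[nu]_x (h n x)%:E @[n --> \oo]).
  under eq_integral => x _ do rewrite -(cvg_lim _ (hf x))//.
  apply: monotone_convergence => //.
  - by move=> n; exact/measurable_EFinP.
  - by move=> n x _ //=; rewrite lee_fin.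
  - by move=> x _ a b ab; rewrite lee_fin; exact/lefP/nd_nnsfun_approx.
have -> : \int[mu]_x (f x * (g x)%:E) =
    lim (\int[mu]_x ((h n x)%:E * (g x)%:E) @[n --> \oo]).
  have fg x : (h n x)%:E * (g x)%:E @[n --> \oo] --> f x * (g x)%:E.
    by apply: cvgeZr => //; exact: hf.
  under eq_integral => x _ do rewrite -(cvg_lim _ (fg x))//.
  apply: monotone_convergence => //.
  - by move=> n; apply: emeasurable_funM => //; exact/measurable_EFinP.
  - by move=> n x _ /=; rewrite mule_ge0// lee_fin.
  - move=> x _ a b ab/=; rewrite lee_wpmul2r ?lee_fin//.
    exact/lefP/nd_nnsfun_approx.
suff suf n : \int[mu]_x ((h n x)%:E * (g x)%:E) = \int[nu]_x (h n x)%:E.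
  by apply: congr_lim; apply/funext => n; rewrite -suf.
transitivity (\int[nu]_x
   (\sum_(y \in range (h n)) (y * \1_(h n @^-1` [set y]) x)%:E)); last first.
  by apply: eq_integral => t tE; rewrite /= [in RHS]fimfunE -fsumEFin.
rewrite ge0_integral_fsum//; first last.
- by move=> y x _; exact: nnfun_muleindic_ge0.
- by move=> y; apply/measurable_EFinP; exact: measurable_funM.
transitivity (\int[mu]_x (\sum_(y \in range (h n))
    (y * \1_(h n @^-1` [set y]) x)%:E * (g x)%:E)).
  under [RHS]eq_integral => x xE.
    rewrite -ge0_mule_fsuml => [|y]; last exact: nnfun_muleindic_ge0.
    rewrite fsumEFin // -(fimfunE _ x); over.
  by [].
rewrite ge0_integral_fsum//; first last.
- by move=> y x _; rewrite mule_ge0 ?lee_fin// -lee_fin nnfun_muleindic_ge0.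
- move=> y; apply: emeasurable_funM => //.
  by apply/measurable_EFinP; exact: measurable_funM.
apply: eq_fsbigr => r rhn.
under [RHS]eq_integral do rewrite EFinM.
rewrite integralZl_indic_nnsfun => //.
under eq_integral do rewrite EFinM -muleA.
have r0 : (0 <= r)%R by move: rhn; rewrite inE => -[x _ <-].
rewrite ge0_integralZl//.
- under eq_integral do rewrite muleC.
  rewrite (eq_integral ((EFin \o g) \_ (h n @^-1` [set r]))); last first.
    by move=> x xE; rewrite epatch_indic.
  by rewrite -integral_mkcondr setTI -nuE// integral_indic// setIT.
- apply: emeasurable_funM => //; exact/measurable_EFinP.
- by move=> x _; rewrite mule_ge0 ?lee_fin.
Qed.

End density.

(** * Exponential moments and symmetry of the centred normal law *)

Section gaussian.
Context {d} {T : measurableType d} {R : realType} (P : probability T R).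
Variables (sigma : R) (X : T -> R).
Hypotheses (sigma0 : sigma != 0) (mX : measurable_fun [set: T] X).
Hypothesis XE : forall B, measurable B -> P (X @^-1` B) = normal_prob 0 sigma B.

Lemma ge0_integral_normal (f : R -> \bar R) :
  measurable_fun [set: R] f -> (forall x, 0 <= f x)%E ->
  (\int[P]_w f (X w) =
   \int[lebesgue_measure]_x (f x * (normal_pdf 0 sigma x)%:E))%E.
Proof.
move=> mf f0.
have mX' : @measurable_fun _ _ T (measurableTypeR R) setT X by exact: mX.
pose X' : {mfun T >-> measurableTypeR R} :=
  HB.pack X (isMeasurableFun.Build _ _ _ _ _ mX').
transitivity (\int[pushforward P X']_x f x)%E.
  by rewrite ge0_integral_pushforward.
apply: (ge0_integral_density lebesgue_measure (pushforward P X')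
  (normal_pdf 0 sigma)) => //.
- exact: measurable_normal_pdf.
- by move=> x; exact: normal_pdf_ge0.
Qed.

Lemma integral_normal_expR s :
  (\int[P]_w (expR (s * X w))%:E = (expR (s ^+ 2 * sigma ^+ 2 / 2))%:E)%E.
Proof.
rewrite (ge0_integral_normal (fun x => (expR (s * x))%:E)); first last.
- by move=> x; rewrite lee_fin expR_ge0.
- apply/measurable_EFinP/measurableT_comp => //.
(* Completing the square: tilting by [expR (s * x)] moves the mean of the normal density to
   [s * sigma ^+ 2]. *)
transitivity (\int[lebesgue_measure]_x ((expR (s ^+ 2 * sigma ^+ 2 / 2))%:E *
    (normal_pdf (s * sigma ^+ 2) sigma x)%:E))%E.
  apply: eq_integral => x _; rewrite -!EFinM; congr EFin.
  rewrite !normal_pdfE// /normal_fun mulrCA [RHS]mulrCA; congr (_ * _).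
  rewrite -!expRD; congr expR; rewrite -mulr_natr; field; exact: sigma0.
rewrite ge0_integralZl//.
- by rewrite integral_normal_pdf mule1.
- by apply/measurable_EFinP; exact: measurable_normal_pdf.
- by move=> x _; rewrite lee_fin normal_pdf_ge0.
Qed.

(** Both Lebesgue measure and the centred density are invariant under reflection. *)
Lemma integral_normalN (f : R -> \bar R) :
  measurable_fun [set: R] f -> (forall x, 0 <= f x)%E ->
  (\int[P]_w f (- X w)%R = \int[P]_w f (X w))%E.
Proof.
move=> mf f0; rewrite (ge0_integral_normal (fun x => f (- x)%R))//; last first.
  exact: measurableT_comp.
rewrite (ge0_integral_normal f)//.
have mfp : measurable_fun [set: R]
    (fun x => (f x * (normal_pdf 0 sigma x)%:E)%E).
  apply: emeasurable_funM => //.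
  by apply/measurable_EFinP; exact: measurable_normal_pdf.
transitivity (\int[pushforward (@lebesgue_measure R) (-%R : _ -> measurableTypeR R)]_x
  (f x * (normal_pdf 0 sigma x)%:E))%E.
  rewrite ge0_integral_pushforward.
  - apply: eq_integral => x _ /=; congr (_ * _%:E)%E.
    by rewrite !normal_pdfE// /normal_fun !subr0 sqrrN.
  - exact: oppr_measurable.
  - exact: measurableT.
  - exact: mfp.
  - by move=> x _; rewrite mule_ge0// lee_fin normal_pdf_ge0.
by apply: eq_measure_integral => //= A mA AS; exact: lebesgue_measureN.
Qed.

End gaussian.

Lemma expR_le_quadratic {R : realType} (x : R) :
  x <= 2^-1 -> expR x <= 1 + x + 2 * x ^+ 2.
Proof.
move=> x2; have := expR_ge1Dx (- x); have := expRxMexpNx_1 x.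
have := expR_gt0 x; have := expR_gt0 (- x).
set a := expR x; set b := expR (- x) => b0 a0 ab hb.
(* The product equals [1 + x ^+ 2 * (1 - 2 * x)]; combined with [1 - x <= expR (- x)] it bounds
   [expR x] from above. *)
have k : 1 <= (1 + x + 2 * x ^+ 2) * (1 - x).
  have := mulr_ge0 (sqr_ge0 x) (_ : 0 <= 1 - 2 * x); lra.
have k2 : 0 < 1 + x + 2 * x ^+ 2 by have := sqr_ge0 x; have := sqr_ge0 (x + 1); lra.
have : 1 <= (1 + x + 2 * x ^+ 2) * b.
  by apply: (le_trans k); rewrite ler_pM2l.
by move=> h; rewrite -(ler_pM2r b0) ab.
Qed.

(** * Mean cosine and large jumps of a small normal increment *)

Section gaussian_estimates.
Context {d} {T : measurableType d} {R : realType} (P : probability T R).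
Variables (sigma a : R) (X : T -> R).
Hypotheses (sigma0 : sigma != 0) (mX : measurable_fun [set: T] X).
Hypothesis XE : forall B, measurable B -> P (X @^-1` B) = normal_prob 0 sigma B.

Let v := a ^+ 2 * sigma ^+ 2.

Let integrable_expR s : P.-integrable setT (EFin \o (fun w => expR (s * X w))).
Proof.
apply/integrableP; split.
  by apply/measurable_EFinP/measurableT_comp => //; exact: measurable_funM.
under eq_integral do rewrite /= ger0_norm ?expR_ge0//.
by rewrite (integral_normal_expR P sigma X sigma0 mX XE) ltry.
Qed.

Let chE s w : ch (s * X w) = 2^-1 * (expR (s * X w) + expR (- s * X w)).
Proof. by rewrite /ch mulNr mulrC. Qed.

Let integrable_ch s : P.-integrable setT (EFin \o (fun w => ch (s * X w))).
Proof.
rewrite (_ : _ \o _ =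
  (fun w => (2^-1)%:E * ((expR (s * X w))%:E + (expR (- s * X w))%:E))%E).
  apply: integrableZl => //; apply: integrableD => //; exact: integrable_expR.
by apply/funext => w /=; rewrite chE.
Qed.

Let Rintegral_ch s : \int[P]_w ch (s * X w) = expR (s ^+ 2 * sigma ^+ 2 / 2).
Proof.
under eq_Rintegral do rewrite chE.
rewrite RintegralZl//; last first.
  rewrite (_ : _ \o _ = (fun w => (expR (s * X w))%:E + (expR (- s * X w))%:E)%E)//.
  by apply: integrableD => //; exact: integrable_expR.
rewrite RintegralD//; [|exact: integrable_expR..].
rewrite /Rintegral !(integral_normal_expR P sigma X sigma0 mX XE)/= sqrrN.
lra.
Qed.

(** Exact mean of [(ch (a * X) - 1) ^+ 2], obtained from [ch u ^+ 2 = (ch (2 * u) + 1) / 2]. *)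
Let q := expR (2 * v) / 2 - 2 * expR (v / 2) + 3 / 2.

Let chsqE w : (ch (a * X w) - 1) ^+ 2 =
  (2^-1 * ch (2 * a * X w) - 2 * ch (a * X w)) + 3 / 2.
Proof.
rewrite /ch -mulrA mulr_natl mulr2n -mulNr.
rewrite opprD !expRD.
have := expRxMexpNx_1 (a * X w); rewrite mulNr.
by set x := expR _; set y := expR _ => h; field: h.
Qed.

Let integrable_cst r : P.-integrable setT (EFin \o (fun=> r)).
Proof. exact: finite_measure_integrable_cst. Qed.

Let Rintegral_cst1 r : \int[P]_w r = r.
Proof.
rewrite Rintegral_cst//; transitivity (r * fine (1 : \bar R)).
  by congr (_ * fine _); exact: probability_setT.
by rewrite mulr1.
Qed.

Let integrable_chsq : P.-integrable setT (EFin \o (fun w => (ch (a * X w) - 1) ^+ 2)).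
Proof.
rewrite (_ : _ \o _ = (fun w => ((2^-1)%:E * (ch (2 * a * X w))%:E -
   2%:E * (ch (a * X w))%:E) + (3 / 2)%:E)%E).
  apply: integrableD => //; last exact: (integrable_cst (3 / 2)).
  apply: integrableB => //; apply: integrableZl => //; exact: integrable_ch.
by apply/funext => w /=; rewrite chsqE.
Qed.

Let Rintegral_chsq : \int[P]_w (ch (a * X w) - 1) ^+ 2 = q.
Proof.
have i1 := integrable_ch (2 * a); have i2 := integrable_ch a.
under eq_Rintegral do rewrite chsqE.
have i3 : P.-integrable setT (EFin \o (fun w => 2^-1 * ch (2 * a * X w))).
  by rewrite (_ : _ \o _ = (fun w => (2^-1)%:E * (ch (2 * a * X w))%:E)%E)//;
    apply: integrableZl.
have i4 : P.-integrable setT (EFin \o (fun w => 2 * ch (a * X w))).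
  by rewrite (_ : _ \o _ = (fun w => 2%:E * (ch (a * X w))%:E)%E)//;
    apply: integrableZl.
have i5 : P.-integrable setT
    (EFin \o (fun w => 2^-1 * ch (2 * a * X w) - 2 * ch (a * X w))).
  rewrite (_ : _ \o _ = (fun w =>
    (2^-1 * ch (2 * a * X w))%:E - (2 * ch (a * X w))%:E)%E)//.
  exact: integrableB.
rewrite (RintegralD measurableT i5 (integrable_cst _)).
rewrite (RintegralB measurableT i3 i4) Rintegral_cst1.
rewrite (RintegralZl _ measurableT i1) (RintegralZl _ measurableT i2) !Rintegral_ch.
by rewrite /q /v; congr (_ - _ + _); rewrite mulrC; congr (expR _ / 2); field.
Qed.

Let measurable_aX : measurable_fun setT (fun w => a * X w).
Proof. exact: measurable_funM. Qed.

Let integrable_cos : P.-integrable setT (EFin \o (fun w => cos (a * X w))).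
Proof.
apply: integrable_le1 => [|w]; last exact: cos_max.
apply: measurableT_comp => //.
by apply: continuous_measurable_fun; exact: continuous_cos.
Qed.

Let measurable_sin : measurable_fun [set: R] (@sin R).
Proof. by apply: continuous_measurable_fun; exact: continuous_sin. Qed.

Let integrable_sin : P.-integrable setT (EFin \o (fun w => sin (a * X w))).
Proof.
apply: integrable_le1 => [|w]; last exact: sin_max.
exact: measurableT_comp.
Qed.

Lemma normal_sin_eq0 : \int[P]_w sin (a * X w) = 0.
Proof.
(* The symmetry lemma concerns nonnegative functions, so the odd function [sin] is shifted by
   [1]. *)
have h : (\int[P]_w (1 + sin (a * - X w))%:E = \int[P]_w (1 + sin (a * X w))%:E)%E.
  apply: (integral_normalN P sigma X sigma0 mX XE (fun x => (1 + sin (a * x))%:E)) => /=.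
    apply/measurable_EFinP/measurable_funD => //.
    by apply: measurableT_comp => //; exact: measurable_funM.
  by move=> x; rewrite lee_fin; have := sin_geN1 (a * x); lra.
have := congr1 fine h; rewrite -!/(Rintegral _ _ _).
have -> : (fun w => 1 + sin (a * - X w)) = (fun w => 1 - sin (a * X w)).
  by apply/funext => w; rewrite mulrN sinN.
rewrite (RintegralD measurableT (integrable_cst _) integrable_sin).
rewrite (RintegralB measurableT (integrable_cst _) integrable_sin); lra.
Qed.

Hypothesis v4 : v <= 4^-1.

Let v0 : 0 <= v. Proof. by rewrite mulr_ge0// sqr_ge0. Qed.

(** The terms of order [0] and [1] in [v] cancel. The bound [v <= 1/4] is what allows
    [expR_le_quadratic] at [2 * v]. *)
Let q_le : q <= 4 * v ^+ 2.
Proof.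
have := @expR_le_quadratic _ (2 * v); have := expR_ge1Dx (v / 2); rewrite /q.
have := v4; have := v0; lra.
Qed.

(** The mean of [2 - ch (a * X)] is [2 - expR (v / 2)], which agrees with [expR (- (v / 2))] to
    first order in [v]. The gap between the hyperbolic bounds has mean [q], also of second order. *)
Lemma normal_cos_bound :
  `|\int[P]_w cos (a * X w) - expR (- (v / 2))| <= 4 * v ^+ 2.
Proof.
have e1 := expR_ge1Dx (- (v / 2)).
have e2 := @expR_le_quadratic _ (- (v / 2)).
have e3 := @expR_le_quadratic _ (v / 2).
have e4 := expR_ge1Dx (v / 2).
have hv := v4; have hv0 := v0.
have i1 := integrable_ch a.
have i2 : P.-integrable setT (EFin \o (fun w => 2 - ch (a * X w))).
  rewrite (_ : _ \o _ = (fun w => 2%:E - (ch (a * X w))%:E)%E)//.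
  by apply: integrableB => //; exact: (integrable_cst 2).
have lo : 2 - expR (v / 2) <= \int[P]_w cos (a * X w).
  apply: (@le_trans _ _ (\int[P]_w (2 - ch (a * X w)))).
    rewrite (RintegralB measurableT (integrable_cst _) i1).
    by rewrite Rintegral_cst1 Rintegral_ch.
  by apply: le_Rintegral => // w _; exact: cos_ge_ch.
have hi : \int[P]_w cos (a * X w) <= 2 - expR (v / 2) + q.
  apply: (@le_trans _ _ (\int[P]_w ((2 - ch (a * X w)) + (ch (a * X w) - 1) ^+ 2))).
    apply: le_Rintegral => // [|w _]; last exact: cos_le_ch.
    rewrite (_ : _ \o _ = (fun w =>
      (2 - ch (a * X w))%:E + ((ch (a * X w) - 1) ^+ 2)%:E)%E)//.
    exact: integrableD.
  rewrite (RintegralD measurableT i2 integrable_chsq).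
  rewrite (RintegralB measurableT (integrable_cst _) i1).
  by rewrite Rintegral_cst1 Rintegral_ch Rintegral_chsq.
have := q_le; rewrite ler_norml; lra.
Qed.

(** Markov's inequality for [4 * (ch (a * X) - 1) ^+ 2], which is at least [(a * eps) ^+ 4] on the
    event since [ch u - 1 >= u ^+ 2 / 2]. Having [v ^+ 2] here makes the sum over [n] steps vanish
    as the mesh shrinks. *)
Lemma normal_tail_bound (eps : R) : a != 0 -> 0 < eps ->
  fine (P [set w | eps <= `|X w|]) <= 16 * v ^+ 2 / (a * eps) ^+ 4.
Proof.
move=> a0 eps0.
have ae0 : 0 < (a * eps) ^+ 4 by rewrite exprn_even_gt0// mulf_neq0// gt_eqF.
have mA : measurable [set w | eps <= `|X w|].
  rewrite -[X in measurable X]setTI.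
  by apply: measurable_fun_le => //; exact: measurableT_comp.
rewrite ler_pdivlMr//.
have -> : fine (P [set w | eps <= `|X w|]) * (a * eps) ^+ 4 =
    \int[P]_(w in [set w | eps <= `|X w|]) ((a * eps) ^+ 4).
  by rewrite Rintegral_cst// mulrC.
apply: (@le_trans _ _ (4 * q)); last by have := q_le; lra.
rewrite -Rintegral_chsq -RintegralZl//.
have i1 : P.-integrable setT (EFin \o (fun w => 4 * (ch (a * X w) - 1) ^+ 2)).
  rewrite (_ : _ \o _ = (fun w => 4%:E * ((ch (a * X w) - 1) ^+ 2)%:E)%E)//.
  exact: integrableZl.
rewrite Rintegral_mkcond; apply: le_Rintegral => //.
  rewrite -restrict_EFin; apply: (proj1 (integrable_mkcond _ mA)).
  by apply: (integrableS measurableT) => //; exact: (integrable_cst _).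
move=> w _; rewrite patchE; case: ifPn; last first.
  by move=> _; rewrite mulr_ge0// sqr_ge0.
rewrite inE/= => Xeps.
have h1 : (a * eps) ^+ 2 <= 2 * (ch (a * X w) - 1).
  have := ch_ge1Dsqr (a * X w).
  suff : (a * eps) ^+ 2 <= (a * X w) ^+ 2 by lra.
  rewrite !exprMn ler_wpM2l ?sqr_ge0// -(real_normK (num_real (X w))).
  by rewrite ler_pXn2r// nnegrE ltW.
have := lerXn2r 2 (_ : _ \is Num.nneg) _ h1; rewrite !nnegrE.
move=> /(_ (sqr_ge0 _)) h2; rewrite (exprM _ 2 2).
apply: le_trans (h2 _) _; last by rewrite exprMn; lra.
by have := ch_ge1 (a * X w); lra.
Qed.

End gaussian_estimates.

(** * Independence of past and future increments *)

Section independence.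
Context {d} {T : measurableType d} {R : realType} (P : probability T R).

(** The joint law of [V] and [X] agrees with the product of the marginals on rectangles, hence
    everywhere, and Fubini factors the integral. *)
Lemma Rintegral_independent (V X : T -> R) (f g : R -> R) :
  measurable_fun setT V -> measurable_fun setT X ->
  measurable_fun setT f -> measurable_fun setT g ->
  (forall x, `|f x| <= 1) -> (forall x, `|g x| <= 1) ->
  (forall B C, measurable B -> measurable C ->
    P (V @^-1` B `&` X @^-1` C) = (P (V @^-1` B) * P (X @^-1` C))%E) ->
  \int[P]_w (f (V w) * g (X w)) =
  (\int[P]_w f (V w)) * (\int[P]_w g (X w)).
Proof.
move=> mV mX mf mg f1 g1 VX.
pose V' : {RV P >-> R} := HB.pack V (isMeasurableFun.Build _ _ _ _ _ mV).
pose X' : {RV P >-> R} := HB.pack X (isMeasurableFun.Build _ _ _ _ _ mX).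
have mVX : measurable_fun setT (fun w => (V w, X w)) by exact: measurable_fun_pair.
pose VX' : {RV P >-> (R * R)%type} :=
  HB.pack (fun w => (V w, X w)) (isMeasurableFun.Build _ _ _ _ _ mVX).
pose F (z : R * R) := f z.1 * g z.2.
have mF : measurable_fun setT F.
  apply: measurable_funM.
    by apply: measurableT_comp => //; exact: measurable_fst.
  by apply: measurableT_comp => //; exact: measurable_snd.
have F1 z : `|F z| <= 1.
  by rewrite normrM mulr_ile1.
pose m1 := distribution P V'; pose m2 := distribution P X'.
have m12 Z : measurable Z -> (m1 \x m2)%E Z = distribution P VX' Z.
  by apply: product_measure_unique => B C mB mC; rewrite -VX.
have iF : (m1 \x m2)%E.-integrable setT (EFin \o F).
  apply: measurable_bounded_integrable => //.
    have P1 : (distribution P VX' setT < +oo)%E by exact: fin_num_fun_lty.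
    exact: (eq_ind_r (fun x => x < +oo)%E P1 (m12 _ measurableT)).
  exists 1; split; first exact: num_real.
  by move=> M M1 w _ /=; apply: le_trans (F1 w) (ltW M1).
have ig : m2.-integrable setT (EFin \o g) by exact: integrable_le1.
have if' : m1.-integrable setT (EFin \o f) by exact: integrable_le1.
have ifV : P.-integrable setT ((EFin \o f) \o V').
  by apply: (integrable_le1 P (f \o V)) => [|w];
    [exact: (measurableT_comp mf mV)|exact: f1].
have igX : P.-integrable setT ((EFin \o g) \o X').
  by apply: (integrable_le1 P (g \o X)) => [|w];
    [exact: (measurableT_comp mg mX)|exact: g1].
have iFVX : P.-integrable setT ((EFin \o F) \o VX').
  by apply: (integrable_le1 P (F \o (fun w => (V w, X w)))) => [|w];
    [exact: (measurableT_comp mF mVX)|exact: F1].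
have gE : \int[m2]_y g y = \int[P]_w g (X w).
  by rewrite /Rintegral integral_distribution//; exact/measurable_EFinP.
have fE : \int[m1]_y f y = \int[P]_w f (V w).
  by rewrite /Rintegral integral_distribution//; exact/measurable_EFinP.
rewrite -gE -fE -RintegralZr//.
transitivity (fine (\int[m1 \x m2]_z (F z)%:E)%E).
  rewrite (@eq_measure_integral _ _ _ _ (distribution P VX')); last first.
    by move=> A mA _; exact: m12.
  by rewrite integral_distribution//; exact/measurable_EFinP.
rewrite -(integral12_prod_meas1 iF); congr fine; apply: eq_integral => x _.
transitivity ((f x)%:E * \int[m2]_y (g y)%:E)%E.
  rewrite -(integralZl measurableT ig); apply: eq_integral => y _.
  by rewrite -EFinM.
by rewrite EFinM; congr (_ * _)%E; rewrite /Rintegral fineK//; exact: integrable_fin_num.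
Qed.

End independence.

(** * Independence of a variable from its predecessors *)

Section past.
Context {d} {T : measurableType d} {R : realType} (P : probability T R).
Variables (X : nat -> T -> R) (n : nat).

(** A family closed under intersection, so that finite measures agreeing on it agree on the
    sigma-algebra generated by the first [n] variables. *)
Definition past_cylinders : set (set T) :=
  [set A | exists2 B : nat -> set R, (forall i, measurable (B i)) &
     A = \bigcap_(i in [set i | (i < n)%N]) X i @^-1` B i].

Hypothesis mX : forall i, measurable_fun setT (X i).
Hypothesis indepX : mutually_independent_rvs P (fun i : 'I_n.+1 => X i).

Let mpreX i (B : set R) : measurable B -> measurable (X i @^-1` B).
Proof. by move=> mB; rewrite -[X in measurable X]setTI; exact: mX. Qed.

Let cylinder_measurable : past_cylinders `<=` measurable.
Proof.
move=> _ [B mB ->]; apply: bigcap_measurableType => // i _; exact: mpreX.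
Qed.

Let cylinder_indep (B : nat -> set R) C : (forall i, measurable (B i)) ->
  measurable C ->
  P ((\bigcap_(i in [set i | (i < n)%N]) X i @^-1` B i) `&` X n @^-1` C) =
  (\prod_(i < n) P (X i @^-1` B i) * P (X n @^-1` C))%E.
Proof.
move=> mB mC.
have := indepX (fun i : 'I_n.+1 => if (i < n)%N then B i else C).
rewrite big_ord_recr/= ltnn.
under eq_bigr do rewrite ltn_ord.
move=> <-; last by move=> i; case: ifP.
congr (P _); apply/seteqP; split => w.
- move=> [h hn] [i /= i_lt] _ /=; case: ifPn => i_n; first exact: h.
  by have -> : i = n; [apply/eqP; rewrite eqn_leq -ltnS i_lt leqNgt|].
- move=> h; split.
    move=> i/= i_n; have := h (Ordinal (ltnW i_n : (i < n.+1)%N)) I => /=.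
    by rewrite i_n.
  by have := h ord_max I; rewrite /= ltnn.
Qed.

(** As functions of [A], the two sides are finite measures (a restriction and a multiple of [P])
    that coincide on cylinders. *)
Lemma past_independent A C : <<s past_cylinders >> A -> measurable C ->
  P (A `&` X n @^-1` C) = (P A * P (X n @^-1` C))%E.
Proof.
move=> sA mC.
have mXC := mpreX n C mC.
have p0 : 0 <= fine (P (X n @^-1` C)) by exact: fine_ge0.
transitivity (mrestr P mXC A) => //.
transitivity (mscale (NngNum p0) P A); last first.
  by rewrite /mscale/= fineK ?fin_num_measure// muleC.
apply: (g_sigma_algebra_measure_unique past_cylinders _ (fun=> setT)) sA => //.
- move=> _; exists (fun=> setT) => //.
  by apply/seteqP; split.
- by apply/seteqP; split => // w _; exists 0%N.
- move=> _ _ [B mB ->] [B' mB' ->]; exists (fun i => B i `&` B' i).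
    by move=> i; exact: measurableI.
  by rewrite -bigcapI.
- move=> _ [B mB ->]; rewrite /mrestr/= /mscale/= fineK ?fin_num_measure//.
  etransitivity; first exact: (cylinder_indep B C mB mC).
  rewrite muleC; congr (_ * _)%E.
  (* Taking the whole line for the last variable identifies the product over [i < n] with the
     probability of the cylinder. *)
  have := cylinder_indep B setT mB measurableT.
  rewrite preimage_setT setIT => h; etransitivity; last exact/esym/h.
  by rewrite probability_setT mule1.
- by move=> _; apply: fin_num_fun_lty; exact: fin_num_measure.
Qed.

End past.

(** * Gaussian walks confined to an interval *)

Section confined_walk.
Context {d} {T : measurableType d} {R : realType} (P : probability T R).
Variables (X : nat -> T -> R) (sigma : R).
Hypothesis sigma0 : sigma != 0.
Hypothesis mX : forall i, measurable_fun setT (X i).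
Hypothesis indepX : forall n, mutually_independent_rvs P (fun i : 'I_n.+1 => X i).
Hypothesis XE : forall i B, measurable B -> P (X i @^-1` B) = normal_prob 0 sigma B.

Definition walk (n : nat) (w : T) : R := \sum_(i < n) X i w.

Definition confined (rho : R) (n : nat) : set T :=
  \bigcap_(k in [set k | (k <= n)%N]) [set w | `|walk k w| <= rho].

Lemma confinedS rho n :
  confined rho n.+1 = confined rho n `&` [set w | `|walk n.+1 w| <= rho].
Proof.
apply/seteqP; split => w.
  by move=> h; split => [k /= kn|]; apply: h => //=; exact: leqW.
move=> [h1 h2] k /=; rewrite leq_eqVlt => /predU1P[->//|]; exact: h1.
Qed.

Let mX_past n i : (i < n)%N ->
  measurable_fun setT (X i : g_sigma_algebraType (past_cylinders X n) -> R).
Proof.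
move=> i_n _ B mB; rewrite setTI; apply: sub_sigma_algebra.
exists (fun j => if j == i then B else setT) => [j|]; first by case: ifP.
apply/seteqP; split => w /=.
  by move=> h j /= j_n; case: eqP => [->|//].
by move/(_ i i_n); rewrite /= eqxx.
Qed.

Let measurable_walk_past n k : (k <= n)%N ->
  measurable_fun setT (walk k : g_sigma_algebraType (past_cylinders X n) -> R).
Proof.
move=> kn; apply: measurable_sum => i; apply: mX_past.
exact: leq_trans (ltn_ord i) kn.
Qed.

Let measurable_confined_past rho n :
  measurable (confined rho n : set (g_sigma_algebraType (past_cylinders X n))).
Proof.
apply: bigcap_measurableType => k /= kn.
rewrite -[X in measurable X]setTI; apply: measurable_fun_le => //.
by apply: measurableT_comp => //; exact: measurable_walk_past.
Qed.

Lemma measurable_walk n : measurable_fun setT (walk n).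
Proof. by apply: measurable_sum => i; exact: mX. Qed.

Lemma measurable_confined rho n : measurable (confined rho n).
Proof.
apply: bigcap_measurableType => k /= kn.
rewrite -[X in measurable X]setTI; apply: measurable_fun_le => //.
by apply: measurableT_comp => //; exact: measurable_walk.
Qed.

Section step.
Variables (a rho eps : R).
Hypotheses (a0 : a != 0) (rho0 : 0 <= rho) (eps0 : 0 < eps).
Let v := a ^+ 2 * sigma ^+ 2.
Hypothesis v4 : v <= 4^-1.

Let m n := \int[P]_(w in confined rho n) cos (a * walk n w).
(** Error per step in units of [v ^+ 2]: [4] from the mean cosine, the rest from jumps of size
    [eps]. *)
Let C := 4 + 16 / (a * eps) ^+ 4.

Let measurable_cos : measurable_fun [set: R] (@cos R).
Proof. by apply: continuous_measurable_fun; exact: continuous_cos. Qed.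

Let measurable_sin : measurable_fun [set: R] (@sin R).
Proof. by apply: continuous_measurable_fun; exact: continuous_sin. Qed.

Let integrable_cos_walk n : P.-integrable setT (EFin \o (fun w => cos (a * walk n w))).
Proof.
apply: integrable_le1 => [|w]; last exact: cos_max.
apply: measurableT_comp => //; apply: measurable_funM => //.
exact: measurable_walk.
Qed.

Let integral_split n (f g : R -> R) :
  measurable_fun setT f -> measurable_fun setT g ->
  (forall x, `|f x| <= 1) -> (forall x, `|g x| <= 1) ->
  \int[P]_(w in confined rho n) (f (a * walk n w) * g (a * X n w)) =
  (\int[P]_(w in confined rho n) f (a * walk n w)) * \int[P]_w g (a * X n w).
Proof.
move=> mf mg f1 g1; set D := confined rho n.
pose V := (fun w => f (a * walk n w)) \_ D.
have V1 w : `|V w| <= 1 by rewrite /V patchE; case: ifP => // _; rewrite normr0.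
have mVpast : measurable_fun setT (V : g_sigma_algebraType (past_cylinders X n) -> R).
  apply/(measurable_restrictT _ (measurable_confined_past rho n)).
  apply: measurable_funTS; apply: measurableT_comp => //.
  by apply: measurable_funM => //; exact: measurable_walk_past.
have mV : measurable_fun setT V.
  apply/(measurable_restrictT _ (measurable_confined rho n)).
  apply: measurable_funTS; apply: measurableT_comp => //.
  by apply: measurable_funM => //; exact: measurable_walk.
(* [Rintegral_independent] wants outer functions bounded by [1] on the whole line; [clip] replaces
   the identity and fixes all values of [V]. *)
pose clip (x : R) := Num.max (-1) (Num.min x 1).
have clip1 x : `|clip x| <= 1.
  by rewrite ler_norml /clip le_max lexx/= ge_max ge_min lexx orbT/=; lra.
have clipV w : clip (V w) = V w.
  have := V1 w; rewrite ler_norml => /andP[h1 h2].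
  by rewrite /clip (min_idPl h2) (max_idPr h1).
have mclip : measurable_fun setT clip.
  by apply: measurable_maxr => //; exact: measurable_minr.
transitivity (\int[P]_w (clip (V w) * (g \o *%R a) (X n w))).
  rewrite Rintegral_mkcond; apply: eq_Rintegral => w _.
  by rewrite clipV /V !patchE; case: ifP => //; rewrite mul0r.
rewrite (Rintegral_independent P V (X n)) => //.
- by congr (_ * _); rewrite [RHS]Rintegral_mkcond; apply: eq_Rintegral => w _; rewrite clipV.
- by apply: measurableT_comp => //; exact: measurable_funM.
- by move=> x; exact: g1.
- move=> B E mB mE; apply: (past_independent P X n) => //.
  by have := mVpast measurableT B mB; rewrite setTI.
Qed.

(** Addition formula for the cosine; the sine product integrates to [0] because the next increment
    is symmetric and independent of the past. *)
Let step_eq n : \int[P]_(w in confined rho n) cos (a * walk n.+1 w) =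
  m n * \int[P]_w cos (a * X n w).
Proof.
have mD := measurable_confined rho n.
have mw k : measurable_fun setT (fun w => a * walk k w).
  by apply: measurable_funM => //; exact: measurable_walk.
have mx k : measurable_fun setT (fun w => a * X k w) by exact: measurable_funM.
rewrite -(integral_split n (@cos R) (@cos R)) //; [|exact: cos_max..].
transitivity (\int[P]_(w in confined rho n)
    (cos (a * walk n w) * cos (a * X n w) - sin (a * walk n w) * sin (a * X n w))).
  by apply: eq_Rintegral => w _; rewrite /walk big_ord_recr/= mulrDr cosD.
rewrite RintegralB//.
- rewrite (integral_split n (@sin R) (@sin R)) //; [|exact: sin_max..].
  by rewrite (normal_sin_eq0 P sigma a (X n) sigma0 (mX n) (XE n)) mulr0 subr0.
- apply: (integrableS measurableT) => //.
  apply: integrable_le1 => [|w]; last by rewrite normrM mulr_ile1// cos_max.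
  by apply: measurable_funM; apply: measurableT_comp.
- apply: (integrableS measurableT) => //.
  apply: integrable_le1 => [|w]; last by rewrite normrM mulr_ile1// sin_max.
  by apply: measurable_funM; apply: measurableT_comp.
Qed.

Let restrict_integrable n k : P.-integrable setT
  (EFin \o ((fun w => cos (a * walk k w)) \_ (confined rho n))).
Proof.
apply: integrable_le1 => [|w]; last first.
  by rewrite patchE; case: ifP => _; rewrite ?normr0// cos_max.
apply/(measurable_restrictT _ (measurable_confined rho n)).
apply: measurable_funTS; apply: measurableT_comp => //.
by apply: measurable_funM => //; exact: measurable_walk.
Qed.

Let norm_m_le1 n : `|m n| <= 1.
Proof.
have iD := integrableS measurableT (measurable_confined rho n)
  (@subsetT _ _) (integrable_cos_walk n).
have P1 : fine (P (confined rho n)) <= 1.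
  have := probability_le1 P (measurable_confined rho n).
  by rewrite -lee_fin fineK// fin_num_measure//; exact: measurable_confined.
apply: (le_trans (le_normr_Rintegral (measurable_confined rho n) iD)).
apply: le_trans P1; rewrite -[leRHS]mul1r -Rintegral_cst; last exact: measurable_confined.
apply: le_Rintegral => [|||w _]; [exact: measurable_confined| | |exact: cos_max].
- exact: (integrable_norm iD).
- apply: finite_measure_integrable_cst; exact: measurable_confined.
Qed.

(* Beyond [rho] the walk either lands in [rho < |y| < rho + eps], where the sign
   of the cosine is known, or has made a jump of size [eps]. The lower bound on
   the confinement probability uses [s = 1], the upper bound [s = -1]. *)
Section sign.
Variable s : R.
Hypothesis s1 : `|s| <= 1.
Hypothesis s_cos : forall y, rho < `|y| < rho + eps -> s * cos (a * y) <= 0.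

Let E n := [set w | eps <= `|X n w|].

Let mE n : measurable (E n).
Proof.
rewrite -[X in measurable X]setTI; apply: measurable_fun_le => //.
exact: measurableT_comp.
Qed.

Let step_tail n :
  s * (m n * \int[P]_w cos (a * X n w)) <= s * m n.+1 + fine (P (E n)).
Proof.
rewrite -step_eq /m !(Rintegral_mkcond _ (confined _ _)).
have -> : fine (P (E n)) = \int[P]_w (\1_(E n) w).
  by rewrite /Rintegral integral_indic// setIT.
have iE : P.-integrable setT (EFin \o (\1_(E n) : T -> R)).
  by apply: integrable_le1 => // w; rewrite indicE; case: (_ \in _); rewrite ?normr1 ?normr0.
have iZ k l : P.-integrable setT
   (EFin \o (fun w => s * ((fun w => cos (a * walk k w)) \_ (confined rho l)) w)).
  by apply: (integrableZl _ s (restrict_integrable l k)).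
rewrite -!RintegralZl// -RintegralD//; apply: le_Rintegral => //.
  by apply: (integrableD _ (iZ n.+1 n.+1) iE).
move=> w _; rewrite !patchE confinedS in_setI indicE.
have [wD|wD] := boolP (w \in confined rho n) => /=; last first.
  by rewrite mulr0 add0r ler0n.
case: ifPn => [_|]; first by rewrite lerDl ler0n.
rewrite notin_setE/= => /negP; rewrite -ltNge mulr0 add0r => rho_lt.
have [wE|] := boolP (w \in E n).
  by rewrite (le_trans (ler_norm _))// normrM mulr_ile1// cos_max.
rewrite notin_setE/= => /negP; rewrite -ltNge => ltE.
apply: s_cos; rewrite rho_lt/= /walk big_ord_recr/= (le_lt_trans (ler_normD _ _))//.
rewrite ler_ltD//; move: wD; rewrite inE => /(_ n); apply => /=; exact: leqnn.
Qed.

Let v0 : 0 <= v. Proof. by rewrite mulr_ge0// sqr_ge0. Qed.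

Let step_bound n :
  s * m n * expR (- (v / 2)) <= s * m n.+1 + C * v ^+ 2.
Proof.
have := normal_tail_bound P sigma a (X n) sigma0 (mX n) (XE n) v4 eps a0 eps0.
have := normal_cos_bound P sigma a (X n) sigma0 (mX n) (XE n) v4.
have := step_tail n; rewrite -/v -/(E n).
set h := \int[P]_w _; set e := expR _; set p := fine _ => h1 h2 h3.
have h4 : s * m n * (e - h) <= 4 * v ^+ 2.
  rewrite (le_trans (ler_norm _))// normrM distrC; apply: le_trans h2.
  by rewrite ler_piMl// normrM mulr_ile1.
rewrite /C [_ * v ^+ 2]mulrDl.
have -> : 16 / (a * eps) ^+ 4 * v ^+ 2 = 16 * v ^+ 2 / (a * eps) ^+ 4 by rewrite mulrAC.
lra.
Qed.

(** Iterates [step_bound]. Earlier errors are multiplied by [expR (- (v / 2)) <= 1], so they at most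
    add up. *)
Lemma confined_cos_bound n :
  s * expR (- (n%:R * (v / 2))) <=
  s * (\int[P]_(w in confined rho n) cos (a * walk n w)) + n%:R * (C * v ^+ 2).
Proof.
rewrite -/(m n); elim: n => [|n IH].
  rewrite !mul0r oppr0 expR0 addr0 /m; have -> : confined rho 0 = setT.
    apply/seteqP; split => // w _ k /=; rewrite leqn0 => /eqP ->.
    by rewrite /walk big_ord0 normr0.
  under eq_Rintegral do rewrite /walk big_ord0 mulr0 cos0.
  rewrite Rintegral_cst// le_eqVlt; apply/orP; left; apply/eqP.
  by congr (s * _); rewrite mul1r; apply: esym; exact: (congr1 fine (probability_setT P)).
have -> : - (n.+1%:R * (v / 2)) = - (n%:R * (v / 2)) + - (v / 2).
  by rewrite -natr1; lra.
rewrite expRD; set e := expR (- (v / 2)).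
have e1 : e <= 1 by rewrite expR_le1; have := v0; lra.
have e0 : 0 < e by exact: expR_gt0.
have C0 : 0 <= n%:R * (C * v ^+ 2).
  rewrite mulr_ge0// mulr_ge0 ?sqr_ge0// addr_ge0// divr_ge0//.
  by rewrite exprn_even_ge0.
have h1 := step_bound n; rewrite -/e in h1.
have h2 : s * expR (- (n%:R * (v / 2))) * e <= s * m n * e + n%:R * (C * v ^+ 2).
  apply: (@le_trans _ _ ((s * m n + n%:R * (C * v ^+ 2)) * e)).
    by rewrite ler_pM2r.
  by rewrite mulrDl lerD2l ler_piMr.
have -> : n.+1%:R * (C * v ^+ 2) = n%:R * (C * v ^+ 2) + C * v ^+ 2.
  by rewrite -[n.+1%:R]natr1 mulrDl mul1r.
lra.
Qed.

End sign.

End step.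
End confined_walk.

(** * Two-sided bounds on the confinement probability of a walk *)

Section walk_small_ball.
Context {d} {T : measurableType d} {R : realType} (P : probability T R).
Variables (X : nat -> T -> R) (sigma : R).
Hypothesis sigma0 : sigma != 0.
Hypothesis mX : forall i, measurable_fun setT (X i).
Hypothesis indepX : forall n, mutually_independent_rvs P (fun i : 'I_n.+1 => X i).
Hypothesis XE : forall i B, measurable B -> P (X i @^-1` B) = normal_prob 0 sigma B.

Let cos_abs (a y : R) : 0 <= a -> cos (a * y) = cos (a * `|y|).
Proof. by move=> a0; rewrite -cos_norm normrM (ger0_norm a0). Qed.

Let integrable_cos_confined a rho n :
  P.-integrable (confined X rho n) (EFin \o (fun w => cos (a * walk X n w))).
Proof.
apply: (integrableS measurableT) => //; first exact: measurable_confined.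
apply: integrable_le1 => [|w]; last exact: cos_max.
apply: measurableT_comp.
  by apply: continuous_measurable_fun; exact: continuous_cos.
by apply: measurable_funM => //; exact: measurable_walk.
Qed.

(** Here [a * rho = pi / 2] and [eps = 2 * rho], so in the band just outside [a * |y|] lies between
    [pi / 2] and [3 * pi / 2], where the cosine is nonpositive. Inside, the cosine is at most
    [1]. *)
Lemma confined_lower_bound (rho : R) n :
  0 < rho -> let v := (pi / (2 * rho)) ^+ 2 * sigma ^+ 2 in v <= 4^-1 ->
  expR (- (n%:R * (v / 2))) <=
  fine (P (confined X rho n)) + n%:R * ((4 + 16 / pi ^+ 4) * v ^+ 2).
Proof.
move=> rho0 v v4; set a := pi / (2 * rho).
have pi0 := @pi_gt0 R.
have a0 : 0 < a by rewrite divr_gt0// mulr_gt0.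
have eps0 : 0 < 2 * rho by rewrite mulr_gt0.
have a_rho : a * rho = pi / 2 by rewrite /a; field; rewrite gt_eqF.
have s1 : `|1 : R| <= 1 by rewrite normr1.
have sc y : rho < `|y| < rho + 2 * rho -> 1 * cos (a * y) <= 0.
  move=> /andP[y1 y2]; rewrite mul1r (cos_abs a y (ltW a0)).
  have z1 : pi / 2 < a * `|y| by rewrite -a_rho ltr_pM2l.
  have z2 : a * `|y| < pi / 2 + pi.
    have -> : pi / 2 + pi = a * (rho + 2 * rho).
      by rewrite mulrDr a_rho mulrCA a_rho; lra.
    by rewrite ltr_pM2l.
  have -> : a * `|y| = (a * `|y| - pi) + pi by rewrite subrK.
  rewrite cosDpi oppr_le0 cos_ge0_pihalf//; lra.
have := confined_cos_bound P X sigma sigma0 mX indepX XE a rho (2 * rho)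
  (lt0r_neq0 a0) (ltW rho0) eps0 v4 1 s1 sc n.
have -> : a * (2 * rho) = pi by rewrite mulrCA a_rho; lra.
rewrite -/a -/v !mul1r => h; apply: (le_trans h); rewrite lerD2r.
rewrite -[leRHS]mul1r -Rintegral_cst; last exact: measurable_confined.
apply: le_Rintegral => [|||w _]; [exact: measurable_confined| | |exact: cos_le1].
- exact: integrable_cos_confined.
- by apply: finite_measure_integrable_cst; exact: measurable_confined.
Qed.

Lemma confined_upper_bound (rho kappa : R) n :
  0 < rho -> 0 < kappa < 1 ->
  let v := (kappa * pi / (2 * rho)) ^+ 2 * sigma ^+ 2 in v <= 4^-1 ->
  fine (P (confined X rho n)) * cos (kappa * (pi / 2)) <=
  expR (- (n%:R * (v / 2))) +
  n%:R * ((4 + 16 / ((1 - kappa) * (pi / 2)) ^+ 4) * v ^+ 2).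
Proof.
move=> rho0 /andP[k0 k1] v v4; set a := kappa * pi / (2 * rho).
have pi0 := @pi_gt0 R.
have a0 : 0 < a by rewrite divr_gt0// mulr_gt0.
(* Chosen so that [a * (rho + eps) = pi / 2]: the cosine is still nonnegative in the band, while
   inside it is at least [cos (kappa * (pi / 2))]. *)
pose eps := rho / kappa - rho.
have eps0 : 0 < eps by rewrite subr_gt0 ltr_pdivlMr// gtr_pMr.
have a_rho : a * rho = kappa * (pi / 2) by rewrite /a; field; rewrite gt_eqF.
have a_eps : a * eps = (1 - kappa) * (pi / 2).
  by rewrite /eps mulrBr mulrA a_rho; field; rewrite gt_eqF.
have s1 : `|- 1 : R| <= 1 by rewrite normrN1.
have sc y : rho < `|y| < rho + eps -> - 1 * cos (a * y) <= 0.
  move=> /andP[y1 y2]; rewrite mulN1r oppr_le0 (cos_abs a y (ltW a0)).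
  have z1 : 0 <= a * `|y| by rewrite mulr_ge0// ltW.
  have z2 : a * `|y| < pi / 2.
    have -> : pi / 2 = a * (rho + eps) by rewrite mulrDr a_rho a_eps; lra.
    by rewrite ltr_pM2l.
  by rewrite cos_ge0_pihalf//; lra.
have := confined_cos_bound P X sigma sigma0 mX indepX XE a rho eps
  (lt0r_neq0 a0) (ltW rho0) eps0 v4 (-1) s1 sc n.
rewrite a_eps -/a -/v => h.
suff : fine (P (confined X rho n)) * cos (kappa * (pi / 2)) <=
    \int[P]_(w in confined X rho n) cos (a * walk X n w) by lra.
rewrite mulrC -Rintegral_cst; last exact: measurable_confined.
apply: le_Rintegral => [|||w wD]; [exact: measurable_confined| | |].
- by apply: finite_measure_integrable_cst; exact: measurable_confined.
- exact: integrable_cos_confined.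
have wn : `|walk X n w| <= rho by apply: (wD n) => /=; exact: leqnn.
rewrite (cos_abs a (walk X n w) (ltW a0)) -a_rho.
have h1 : a * `|walk X n w| <= a * rho by rewrite ler_pM2l.
have h2 : a * rho <= pi by rewrite a_rho; nra.
have h3 : 0 <= a * `|walk X n w| by rewrite mulr_ge0// ltW.
have h4 : 0 <= a * rho by rewrite mulr_ge0// ltW.
rewrite leNgt; apply/negP; rewrite ltr_cos ?in_itv/= ?h3 ?h4 ?(le_trans h1 h2)//.
by move=> h5; have := lt_le_trans h5 h1; rewrite ltxx.
Qed.

End walk_small_ball.

(** * Small balls for Brownian motion *)

Definition stays {R : realType} {T : Type} (Y : R -> T -> R) (rho t : R) : set T :=
  [set w | forall s, 0 <= s <= t -> `|Y s w| <= rho].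

Section brownian_small_ball.
Context {d} {T : measurableType d} {R : realType} (P : probability T R).
Variable Y : R -> T -> R.
Hypothesis BM : brownian_motion P Y.
Variables (t : R).
Hypothesis t0 : 0 < t.

Let inc (n i : nat) (w : T) : R :=
  Y (i.+1%:R * (t / n%:R)) w - Y (i%:R * (t / n%:R)) w.

Let walk_inc n k w : walk (inc n) k w = Y (k%:R * (t / n%:R)) w.
Proof.
case: BM => Y0 _ _ _ _; rewrite /walk; elim: k => [|k IH].
  by rewrite big_ord0 mul0r Y0.
by rewrite big_ord_recr/= IH addrC /inc subrK.
Qed.

Let grid rho n := confined (inc n) rho n.

Let gridP rho n w : grid rho n w <->
  forall k, (k <= n)%N -> `|Y (k%:R * (t / n%:R)) w| <= rho.
Proof.
by split => h k /= kn; have := h k kn; rewrite /= walk_inc.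
Qed.

Let delta_gt0 n : (0 < n)%N -> 0 < t / n%:R.
Proof. by move=> n0; rewrite divr_gt0// ltr0n. Qed.

Let minc n : (0 < n)%N -> forall i, measurable_fun setT (inc n i).
Proof.
move=> n0 i; case: BM => _ _ mY _ _; apply: measurable_funB; apply: mY.
all: by rewrite mulr_ge0// ltW// delta_gt0.
Qed.

Let indep_inc n : (0 < n)%N ->
  forall k, mutually_independent_rvs P (fun i : 'I_k.+1 => inc n i).
Proof.
move=> n0 k; case: BM => _ _ _ ind _.
apply: (ind k.+1 (fun i => i%:R * (t / n%:R))); first by rewrite mul0r.
by move=> i _; rewrite ltr_pM2r ?delta_gt0// ltr_nat.
Qed.

Let law_inc n : (0 < n)%N -> forall i B, measurable B ->
  P (inc n i @^-1` B) = normal_prob 0 (Num.sqrt (t / n%:R)) B.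
Proof.
move=> n0 i B mB; case: BM => _ _ _ _ /(_ (i%:R * (t / n%:R)) (i.+1%:R * (t / n%:R))).
have -> : i.+1%:R * (t / n%:R) - i%:R * (t / n%:R) = t / n%:R.
  by rewrite -mulrBl -natrB// subSnn mul1r.
apply => //; first by rewrite mulr_ge0// ltW// delta_gt0.
by rewrite ltr_pM2r ?delta_gt0// ltr_nat.
Qed.

Let sqrt_delta_neq0 n : (0 < n)%N -> Num.sqrt (t / n%:R) != 0.
Proof. by move=> n0; rewrite lt0r_neq0// sqrtr_gt0 delta_gt0. Qed.

(** With step variance [t / n], the condition on [n] says [v <= 1/4], and the accumulated error
    [n * v ^+ 2] is of order [1 / n]. *)
Let grid_lower rho n : 0 < rho -> (0 < n)%N ->
  (pi / (2 * rho)) ^+ 2 * t * 4 <= n%:R ->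
  expR (- (pi ^+ 2 * t / (8 * rho ^+ 2))) <= fine (P (grid rho n)) +
    (4 + 16 / pi ^+ 4) * ((pi / (2 * rho)) ^+ 2 * t) ^+ 2 / n%:R.
Proof.
move=> rho0 n0 hn.
have n0' : 0 < n%:R :> R by rewrite ltr0n.
have := confined_lower_bound P (inc n) _ (sqrt_delta_neq0 n n0) (minc n n0)
  (indep_inc n n0) (law_inc n n0) rho n rho0.
rewrite (sqr_sqrtr (ltW (delta_gt0 n n0))).
set a2 := (pi / (2 * rho)) ^+ 2 => /= h.
have hv : a2 * (t / n%:R) <= 4^-1.
  by rewrite mulrA ler_pdivrMr//; move: hn; rewrite -/a2; lra.
have := h hv.
have -> : n%:R * (a2 * (t / n%:R) / 2) = pi ^+ 2 * t / (8 * rho ^+ 2).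
  by rewrite /a2; field; rewrite !gt_eqF.
set C := 4 + _.
suff -> : n%:R * (C * (a2 * (t / n%:R)) ^+ 2) = C * (a2 * t) ^+ 2 / n%:R by [].
by field; rewrite !gt_eqF.
Qed.

Let grid_upper rho kappa n : 0 < rho -> 0 < kappa < 1 -> (0 < n)%N ->
  (kappa * pi / (2 * rho)) ^+ 2 * t * 4 <= n%:R ->
  fine (P (grid rho n)) * cos (kappa * (pi / 2)) <=
    expR (- (kappa ^+ 2 * pi ^+ 2 * t / (8 * rho ^+ 2))) +
    (4 + 16 / ((1 - kappa) * (pi / 2)) ^+ 4) *
      ((kappa * pi / (2 * rho)) ^+ 2 * t) ^+ 2 / n%:R.
Proof.
move=> rho0 k01 n0 hn.
have n0' : 0 < n%:R :> R by rewrite ltr0n.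
have := confined_upper_bound P (inc n) _ (sqrt_delta_neq0 n n0) (minc n n0)
  (indep_inc n n0) (law_inc n n0) rho kappa n rho0 k01.
rewrite (sqr_sqrtr (ltW (delta_gt0 n n0))).
set a2 := (kappa * pi / (2 * rho)) ^+ 2 => /= h.
have hv : a2 * (t / n%:R) <= 4^-1.
  by rewrite mulrA ler_pdivrMr//; move: hn; rewrite -/a2; lra.
have := h hv.
have -> : n%:R * (a2 * (t / n%:R) / 2) = kappa ^+ 2 * pi ^+ 2 * t / (8 * rho ^+ 2).
  by rewrite /a2; field; rewrite !gt_eqF.
set C := 4 + _.
suff -> : n%:R * (C * (a2 * (t / n%:R)) ^+ 2) = C * (a2 * t) ^+ 2 / n%:R by [].
by field; rewrite !gt_eqF.
Qed.

(** Dyadic meshes are nested, so these events decrease and continuity of [P] from above applies. *)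
Let dyadic rho j := grid rho (2 ^ j).

Let measurable_dyadic rho j : measurable (dyadic rho j).
Proof. by apply: measurable_confined; apply: minc; rewrite expn_gt0. Qed.

Let measurable_process s : 0 <= s ->
  measurable_fun setT (Y s : g_sigma_algebraType
    (\bigcup_(t in [set t : R | 0 <= t])
                   [set Y t @^-1` B | B in (measurable : set (set R))]) -> R).
Proof.
move=> s0 _ B mB; rewrite setTI; apply: sub_sigma_algebra.
by exists s => //; exists B.
Qed.

(** By path continuity, a violation at time [s] persists nearby, hence is seen at a point of a fine
    enough dyadic grid. *)
Lemma stays_dyadic rho : stays Y rho t = \bigcap_j dyadic rho j.
Proof.
apply/seteqP; split => w.
  move=> h j _; apply/gridP => k kj; apply: h; rewrite mulr_ge0//=.
    rewrite mulrCA ler_piMr ?(ltW t0)// ler_pdivrMr ?ltr0n ?expn_gt0// mul1r.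
    by rewrite ler_nat.
  by rewrite ltW// delta_gt0// expn_gt0.
move=> h s /andP[s0 st].
have cY : {within [set t : R | 0 <= t], continuous (fun t => Y t w)} by case: BM.
rewrite leNgt; apply/negP => rho_lt.
have := (subspace_continuousP _ _).1 cY s s0.
move=> /cvg_norm /cvgr_gt /(_ _ rho_lt); rewrite near_withinE.
move=> /nbhs_ballP[e /= e0 he].
(* [2 ^ m > m] with [m > t / e] makes the mesh [t / N] smaller than [e]. *)
pose N := (2 ^ (Num.truncn (t / e)).+1)%N.
have N0 : 0 < N%:R :> R by rewrite ltr0n expn_gt0.
have tN : t / N%:R < e.
  rewrite ltr_pdivrMr// mulrC -ltr_pdivrMr//.
  apply: (lt_trans (truncnS_gt _)); rewrite ltr_nat; exact: ltn_expl.
(* Index of the last grid point not after [s]; this side keeps it inside [[0, t]]. *)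
pose k := Num.truncn (s * N%:R / t).
have x0 : 0 <= s * N%:R / t by rewrite divr_ge0 ?mulr_ge0// ltW.
have sE : s = s * N%:R / t * (t / N%:R) by field; rewrite !gt_eqF.
have d0 : 0 < t / N%:R by rewrite divr_gt0.
have /andP[x1 x2] := truncn_itv x0; rewrite -/k in x1 x2.
have y1 : k%:R * (t / N%:R) <= s by rewrite [leRHS]sE ler_pM2r.
have y2 : s < k%:R * (t / N%:R) + t / N%:R.
  by rewrite [ltLHS]sE -[X in _ + X]mul1r -mulrDl ltr_pM2r// natr1.
have kN : (k <= N)%N.
  rewrite -(ler_nat R) (le_trans x1)// ler_pdivrMr// mulrC ler_pM2l//.
have := he (k%:R * (t / N%:R)) => /=.
have b : ball s e (k%:R * (t / N%:R)) by rewrite /ball/= ger0_norm; lra.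
have k0 : 0 <= k%:R * (t / N%:R) by rewrite mulr_ge0// ltW.
move=> /(_ b k0); apply/negP; rewrite -leNgt.
by have /gridP := h (Num.truncn (t / e)).+1 I; apply.
Qed.

Lemma measurable_stays rho : measurable (stays Y rho t).
Proof. by rewrite stays_dyadic; apply: bigcapT_measurable. Qed.

(** Independence of [xi] is assumed for events of [sigma_process Y], so measurability in the ambient
    space would not suffice. *)
Lemma sigma_process_stays rho : sigma_process Y (stays Y rho t).
Proof.
rewrite stays_dyadic; apply: (@bigcapT_measurable _ (g_sigma_algebraType
    (\bigcup_(t in [set t : R | 0 <= t])
       [set Y t @^-1` B | B in (measurable : set (set R))]))) => j.
rewrite (_ : dyadic rho j = \bigcap_(k in [set k | (k <= 2 ^ j)%N])
    [set w | `|Y (k%:R * (t / (2 ^ j)%:R)) w| <= rho]).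
  apply: bigcap_measurableType => k /= kn.
  rewrite -[X in measurable X]setTI; apply: measurable_fun_le => //.
  apply: measurableT_comp => //; apply: measurable_process.
  by rewrite mulr_ge0// ltW// delta_gt0// expn_gt0.
by apply/seteqP; split => w /gridP.
Qed.

Let nonincreasing_dyadic rho : nonincreasing_seq (dyadic rho).
Proof.
apply/nonincreasing_seqP => j; apply/subsetPset => w /gridP h.
apply/gridP => k kj; have := h (2 * k)%N; rewrite expnS leq_mul2l kj orbT.
move=> /(_ isT); rewrite !natrM; suff -> : 2 * k%:R * (t / (2 * (2 ^ j)%:R)) =
  k%:R * (t / (2 ^ j)%:R) :> R by [].
field; rewrite pnatr_eq0 -lt0n expn_gt0//.
Qed.

Let cvg_dyadic rho :
  fine (P (dyadic rho j)) @[j --> \oo] --> fine (P (stays Y rho t)).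
Proof.
apply: fine_cvg; rewrite fineK ?fin_num_measure//; last exact: measurable_stays.
rewrite stays_dyadic; apply: nonincreasing_cvg_mu => //.
- by rewrite -ge0_fin_numE// fin_num_measure.
- by rewrite -stays_dyadic; exact: measurable_stays.
Qed.

Let cvg_error (K : R) : K / (2 ^ j)%:R @[j --> \oo] --> (0 : R).
Proof.
rewrite (_ : (fun j => _) = geometric K 2^-1).
  by apply: cvg_geometric; rewrite ger0_norm; lra.
by apply/funext => j; rewrite /geometric/= natrX exprVn.
Qed.

Let near_large (x : R) : \forall j \near \oo, x <= (2 ^ j)%:R.
Proof.
near=> j; apply: (@le_trans _ _ j%:R).
  by near: j; exact: nbhs_infty_ger.
by rewrite ler_nat ltnW// ltn_expl.
Unshelve. all: by end_near. Qed.

Lemma stays_lower_bound rho : 0 < rho ->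
  expR (- (pi ^+ 2 * t / (8 * rho ^+ 2))) <= fine (P (stays Y rho t)).
Proof.
move=> rho0; rewrite -[leRHS]addr0.
apply: (cvgr_to_ge (cvgD (cvg_dyadic rho)
  (cvg_error ((4 + 16 / pi ^+ 4) * ((pi / (2 * rho)) ^+ 2 * t) ^+ 2)))).
near=> j; apply: grid_lower => //; first by rewrite expn_gt0.
near: j; exact: near_large.
Unshelve. all: by end_near. Qed.

(** Limit of the grid bound with [kappa] fixed; the factor [cos (kappa * (pi / 2))] does not depend
    on [t] and is negligible on the logarithmic scale. *)
Lemma stays_upper_bound rho kappa : 0 < rho -> 0 < kappa < 1 ->
  fine (P (stays Y rho t)) * cos (kappa * (pi / 2)) <=
  expR (- (kappa ^+ 2 * pi ^+ 2 * t / (8 * rho ^+ 2))).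
Proof.
move=> rho0 k01; rewrite -[leRHS]addr0.
apply: (ler_cvg_to (cvgM (cvg_dyadic rho) (cvg_cst _)) (cvgD (cvg_cst _)
  (cvg_error ((4 + 16 / ((1 - kappa) * (pi / 2)) ^+ 4) *
      ((kappa * pi / (2 * rho)) ^+ 2 * t) ^+ 2)))).
near=> j; apply: grid_upper => //; first by rewrite expn_gt0.
near: j; exact: near_large.
Unshelve. all: by end_near. Qed.

End brownian_small_ball.

(** * Exit times from a random interval *)

Lemma measurable_gt {d} {T : measurableType d} {R : realType} (f : T -> R) r :
  measurable_fun setT f -> measurable [set w | r < f w].
Proof.
move=> mf.
rewrite (_ : [set w | _] = setT `&` f @^-1` `]r, +oo[%classic); first exact: mf.
by rewrite setTI; apply/seteqP; split => w /=; rewrite in_itv/= andbT.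
Qed.

Section exit_time.
Context {d} {T : measurableType d} {R : realType} (P : probability T R).
Variables (xi : T -> R) (Y : R -> T -> R).
Hypothesis mxi : measurable_fun [set: T] xi.
Hypothesis xi_gt0 : forall w, 0 < xi w.
Hypothesis BM : brownian_motion P Y.
Hypothesis indep : independent_sigma P (sigma_rv xi) (sigma_process Y).
Variables (t : R).
Hypothesis t0 : 0 < t.

Let m_xi_gt r : measurable [set w | r < xi w].
Proof. exact: measurable_gt. Qed.

Let contY w : {within [set t : R | 0 <= t], continuous (fun t => Y t w)}.
Proof. by case: BM. Qed.

Let exit_gt : set T := [set w | (t%:E < exit_time Y xi w)%E].

Let exit_gt_inside w s : exit_gt w -> 0 <= s <= t -> `|Y s w| < xi w.
Proof.
move=> tw /andP[s0 st]; rewrite ltNge; apply/negP => xis.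
have : (exit_time Y xi w <= s%:E)%E.
  apply: ereal_inf_lbound; exists s => //; split => //.
  by apply/negP; rewrite -ltr_norml -leNgt.
by apply/negP; rewrite -ltNge (le_lt_trans _ tw)// lee_fin.
Qed.

(** The strict inequality [r < xi w] and continuity at [t] keep the path inside a little beyond [t],
    so the infimum of exit times is strictly larger than [t]. *)
Let stays_exit_gt r w : r < xi w -> stays Y r t w -> exit_gt w.
Proof.
move=> rxi rY.
have := (subspace_continuousP _ _).1 (contY w) t (ltW t0).
have lt_xi : `|Y t w| < xi w by apply: le_lt_trans rxi; apply: rY; rewrite lexx ltW.
move=> /cvg_norm /cvgr_lt /(_ _ lt_xi); rewrite near_withinE.
move=> /nbhs_ballP[e /= e0 he].
rewrite /exit_gt /= (@lt_le_trans _ _ (t + e)%:E)//; first by rewrite lte_fin ltrDl.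
apply: le_ereal_inf_tmp => _ [s [s0 sY] <-]; rewrite lee_fin leNgt; apply/negP => ste.
apply: sY; rewrite -ltr_norml; have [st|ts] := leP s t.
  by apply: le_lt_trans rxi; apply: rY; rewrite s0.
by apply: he => //=; rewrite /ball/= distrC ger0_norm; lra.
Qed.

(** The maximum of [|Y|] on [[0, t]] is attained, hence strictly below [xi w], and a rational fits
    between. The countable union yields measurability. *)
Let exit_gtE : exit_gt =
  \bigcup_(q : rat) ([set w | ratr q < xi w] `&` stays Y (ratr q) t).
Proof.
apply/seteqP; split => w; last by move=> [q _ [] ]; exact: stays_exit_gt.
move=> tw.
have cont : {within `[0, t], continuous (fun s => `|Y s w|)}.
  apply/subspace_continuousP => s; rewrite /= in_itv/= => /andP[s0 st].
  apply: cvg_norm.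
  apply: cvg_trans ((subspace_continuousP _ _).1 (contY w) s s0).
  apply: cvg_app; apply: within_subset => x /=.
  by rewrite in_itv/= => /andP[].
have [s] := EVT_max (ltW t0) cont; rewrite in_itv/= => s0t maxs.
have [q] := rat_in_itvoo (exit_gt_inside w s tw s0t).
rewrite in_itv/= => /andP[q1 q2]; exists q => //; split => //= u u0t.
by apply: le_trans (ltW q1); apply: maxs; rewrite in_itv/=.
Qed.

Lemma measurable_exit_gt : measurable exit_gt.
Proof.
rewrite exit_gtE; apply: bigcupT_measurable_rat => q.
by apply: measurableI => //; exact: (measurable_stays P).
Qed.

Let indep_stays r rho : fine (P ([set w | r < xi w] `&` stays Y rho t)) =
  fine (P [set w | r < xi w]) * fine (P (stays Y rho t)).
Proof.
rewrite (indep [set w | r < xi w] (stays Y rho t)).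
- by rewrite fineM// fin_num_measure//; exact: (measurable_stays P).
- exists `]r, +oo[%classic => //.
  by apply/seteqP; split => w /=; rewrite in_itv/= andbT.
- exact: (sigma_process_stays P).
Qed.

Let le_fineP A B : measurable A -> measurable B -> A `<=` B ->
  fine (P A) <= fine (P B).
Proof.
move=> mA mB AB; rewrite fine_le ?fin_num_measure//.
by apply: le_measure => //; rewrite inE.
Qed.

Lemma exit_tail_lower r : 0 < r ->
  fine (P [set w | r < xi w]) * expR (- (pi ^+ 2 * t / (8 * r ^+ 2))) <=
  fine (P exit_gt).
Proof.
move=> r0; have mS := measurable_stays P Y BM t t0 r.
apply: (@le_trans _ _ (fine (P ([set w | r < xi w] `&` stays Y r t)))).
  by rewrite indep_stays ler_wpM2l ?fine_ge0// stays_lower_bound.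
apply: le_fineP; [exact: measurableI|exact: measurable_exit_gt|].
by move=> w []; exact: stays_exit_gt.
Qed.

(** Splits by the cell [x j < xi <= x j.+1]: survival there forces [|Y| <= x j.+1], and independence
    factors the probability. *)
Lemma exit_tail_upper kappa (x : nat -> R) n : 0 < kappa < 1 ->
  x 0 = 0 -> (forall j, 0 < x j.+1) ->
  fine (P exit_gt) <=
  \sum_(j < n) (fine (P [set w | x j < xi w]) *
    (expR (- (kappa ^+ 2 * pi ^+ 2 * t / (8 * x j.+1 ^+ 2))) / cos (kappa * (pi / 2))))
  + fine (P [set w | x n < xi w]).
Proof.
move=> k01 x0 x_gt0.
have cos_gt0 : 0 < cos (kappa * (pi / 2)).
  have := @pi_gt0 R; move: k01 => /andP[k0 k1] pi0.
  by rewrite cos_gt0_pihalf//; nra.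
(* The remainder keeps the survival event, so that the induction can peel off one more cell from
   it. *)
suff h : fine (P exit_gt) <=
  \sum_(j < n) (fine (P [set w | x j < xi w]) *
    (expR (- (kappa ^+ 2 * pi ^+ 2 * t / (8 * x j.+1 ^+ 2))) / cos (kappa * (pi / 2))))
  + fine (P (exit_gt `&` [set w | x n < xi w])).
  apply: (le_trans h); rewrite lerD2l; apply: le_fineP => //.
  by apply: measurableI => //; exact: measurable_exit_gt.
have mE := measurable_exit_gt.
elim: n => [|n IH].
  rewrite big_ord0 add0r; apply: le_fineP => //; first exact: measurableI.
  by move=> w wE; split => //=; rewrite x0.
apply: (le_trans IH); rewrite big_ord_recr/= -addrA lerD2l.
have mS := measurable_stays P Y BM t t0 (x n.+1).
pose A := [set w | x n < xi w] `&` stays Y (x n.+1) t.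
pose B := exit_gt `&` [set w | x n.+1 < xi w].
have mA : measurable A by exact: measurableI.
have mB : measurable B by exact: measurableI.
apply: (@le_trans _ _ (fine (P (A `|` B)))).
  apply: le_fineP; [exact: measurableI|exact: measurableU|].
  move=> w [wE xn]; have [xw|wx] := ltP (x n.+1) (xi w); first by right.
  left; split => // s s0t; rewrite (le_trans _ wx)// ltW//.
  exact: exit_gt_inside.
apply: (@le_trans _ _ (fine (P A) + fine (P B))).
  rewrite -fineD ?fin_num_measure// fine_le ?fin_num_measure//.
  - exact: measurableU.
  - by rewrite fin_numD !fin_num_measure.
  - exact: measureU2.
rewrite lerD2r indep_stays ler_wpM2l ?fine_ge0//.
by rewrite ler_pdivlMr// stays_upper_bound.
Qed.

End exit_time.

(** * Optimization over the radius *)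

Section power_asymptotics.
Context {R : realType}.
Implicit Types (a b x y t : R) (p F : R -> R).

Lemma powR_expR a x : 0 < a -> a `^ x = expR (x * ln a).
Proof. by move=> a0; rewrite /powR gt_eqF. Qed.

Lemma near_powR_ge x y : 0 < x -> \forall t \near +oo, y <= t `^ x.
Proof.
move=> x0; near=> t.
have t1 : `|y| `^ x^-1 <= t by near: t; exact: nbhs_pinfty_ge.
apply: (le_trans (ler_norm y)).
have -> : `|y| = (`|y| `^ x^-1) `^ x by rewrite -powRrM mulVf ?gt_eqF// powRr1.
by rewrite ge0_ler_powR// ?nnegrE ?powR_ge0// ?(ltW x0)// (le_trans (powR_ge0 _ _) t1).
Unshelve. all: by end_near. Qed.

Lemma asymp_equiv_tail_bounds p (beta c e : R) : 0 < beta -> 0 < c -> 0 < e < 1 ->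
  asymp_equiv (fun t => - ln (p t)) (fun t => c * t `^ beta) ->
  \forall r \near +oo, expR (- ((1 + e) * (c * r `^ beta))) <= p r <=
    expR (- ((1 - e) * (c * r `^ beta))).
Proof.
move=> beta0 c0 /andP[e0 e1] /cvgrPdist_le /(_ _ e0) he.
near=> r.
have r0 : 0 < r by near: r; exact: nbhs_pinfty_gt.
have g0 : 0 < c * r `^ beta by rewrite mulr_gt0// powR_gt0.
have : `|1 - - ln (p r) / (c * r `^ beta)| <= e by near: r.
set g := c * r `^ beta in g0 *.
rewrite ler_distlC => /andP[].
rewrite ler_pdivlMr// ler_pdivrMr// => h1 h2.
have ln_lt0 : ln (p r) < 0.
  by rewrite -oppr_gt0; apply: lt_le_trans h1; rewrite mulr_gt0// subr_gt0.
(* [ln] is [0] on nonpositive reals, so [ln (p r) < 0] gives [0 < p r]. *)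
have p0 : 0 < p r by rewrite ltNge; apply/negP => /ln0 p0; rewrite p0 ltxx in ln_lt0.
rewrite -[p r]lnK ?posrE// !ler_expR; apply/andP; split; lra.
Unshelve. all: by end_near. Qed.

Section optimal_radius.
Variables beta c : R.
Hypotheses (beta0 : 0 < beta) (c0 : 0 < c).

(* [cost x * t ^ (beta / (2 + beta))] is the exponential cost of having
   [xi > r] and [|Y| < r] up to time [t], for [r = x * t ^ (1 / (2 + beta))]. *)
Definition cost x : R := c * x `^ beta + pi ^+ 2 / (8 * x ^+ 2).

(** Critical point of [cost], the solution of [beta * c * x ^ (beta - 1) = pi ^ 2 / (4 * x ^ 3)]. *)
Definition opt_radius : R := (pi ^+ 2 / (4 * beta * c)) `^ (2 + beta)^-1.

Let pi0 : 0 < pi :> R. Proof. exact: pi_gt0. Qed.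

Let b2 : 0 < 2 + beta. Proof. by rewrite addr_gt0. Qed.

Let base0 : 0 < pi ^+ 2 / (4 * beta * c) :> R.
Proof. by rewrite divr_gt0 ?exprn_gt0// !mulr_gt0. Qed.

Lemma opt_radius_gt0 : 0 < opt_radius.
Proof. exact: powR_gt0. Qed.

(** Stationarity multiplied by the radius; it makes the linear terms cancel in [cost_ge]. *)
Let opt_balance :
  beta * (c * opt_radius `^ beta) = 2 * (pi ^+ 2 / (8 * opt_radius ^+ 2)).
Proof.
have x0 := opt_radius_gt0.
have : opt_radius `^ (beta + 2) = pi ^+ 2 / (4 * beta * c).
  by rewrite /opt_radius -powRrM [beta + 2]addrC mulVf ?gt_eqF// powRr1// ltW.
rewrite powRD; last by rewrite (gt_eqF x0) implybT.
rewrite (powR_mulrn 2 (ltW x0)).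
have h : opt_radius ^+ 2 != 0 by rewrite gt_eqF// exprn_gt0.
move=> /(congr1 (fun z => z / opt_radius ^+ 2)); rewrite mulfK// => ->.
set P := pi ^+ 2; field; rewrite (gt_eqF x0) (gt_eqF c0) (gt_eqF beta0) //.
Qed.

(* As a function of [y = ln (x / opt_radius)], [cost] lies above the sum of the
   tangent lines at [y = 0] of its two exponential terms, which is constant. *)
Lemma cost_ge x : 0 < x -> cost opt_radius <= cost x.
Proof.
move=> x0; have z0 := opt_radius_gt0; rewrite /cost.
have bal := opt_balance.
pose y := ln (x / opt_radius).
have xE : x = opt_radius * expR y.
  by rewrite /y lnK ?posrE ?divr_gt0// mulrCA divff ?mulr1// gt_eqF.
have -> : c * x `^ beta = c * opt_radius `^ beta * expR (beta * y).
  by rewrite {1}xE powRM ?expR_ge0 ?(ltW z0)// -expRM mulrA [y * _]mulrC.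
have -> : pi ^+ 2 / (8 * x ^+ 2) = pi ^+ 2 / (8 * opt_radius ^+ 2) * expR (- (2 * y)).
  rewrite {1}xE exprMn mulrA invfM mulrA -expRM_natl -expRN; congr (_ * expR _).
set A := c * opt_radius `^ beta in bal *; set B := pi ^+ 2 / _ in bal *.
have A0 : 0 < A by rewrite mulr_gt0// powR_gt0.
have B0 : 0 < B by rewrite divr_gt0 ?exprn_gt0// mulr_gt0// exprn_gt0.
have h1 : A * (1 + beta * y) <= A * expR (beta * y) by rewrite ler_pM2l// expR_ge1Dx.
have h2 : B * (1 + - (2 * y)) <= B * expR (- (2 * y)) by rewrite ler_pM2l// expR_ge1Dx.
have h3 : A * (beta * y) = B * (2 * y) by rewrite !mulrA [A * _]mulrC bal; ring.
lra.
Qed.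

Lemma cost_opt_gt0 : 0 < cost opt_radius.
Proof.
have z0 := opt_radius_gt0; rewrite addr_gt0//.
  by rewrite mulr_gt0// powR_gt0.
by rewrite divr_gt0 ?exprn_gt0// mulr_gt0// exprn_gt0.
Qed.

Lemma cost_optE : cost opt_radius =
  2 `^ (- (2 * beta) / (2 + beta)) * ((2 + beta) / 2)
  * c `^ (2 / (2 + beta)) * beta `^ (- beta / (2 + beta))
  * pi `^ (2 * beta / (2 + beta)).
Proof.
(* By the balance, the second term of the cost is [beta / 2] times the first. The remaining product
   of powers is compared through logarithms. *)
have -> : cost opt_radius = c * opt_radius `^ beta * ((2 + beta) / 2).
  by rewrite /cost; have := opt_balance; lra.
suff -> : c * opt_radius `^ beta = 2 `^ (- (2 * beta) / (2 + beta)) *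
    c `^ (2 / (2 + beta)) * beta `^ (- beta / (2 + beta)) *
    pi `^ (2 * beta / (2 + beta)) by ring.
rewrite /opt_radius -powRrM !powR_expR//.
rewrite ln_div ?posrE ?exprn_gt0 ?mulr_gt0//.
have -> : ln (pi ^+ 2) = 2 * ln pi :> R by rewrite lnXn// mulr_natl.
have -> : ln (4 * beta * c) = 2 * ln 2 + ln beta + ln c.
  rewrite lnM ?posrE ?mulr_gt0// lnM ?posrE//; congr (_ + _ + _).
  by rewrite (_ : 4 = 2 ^+ 2) ?lnXn ?mulr_natl//; ring.
have {1}-> : c = expR (ln c) by rewrite lnK ?posrE.
rewrite -!expRD; congr expR.
set l2 := ln 2; set lc := ln c; set lb := ln beta; set lp := ln pi.
by field; rewrite gt_eqF.
Qed.

End optimal_radius.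
End power_asymptotics.

(** * Logarithmic asymptotics of the mixed tail *)

Section mixed_tail.
Context {R : realType}.
Variables (beta c : R) (p F : R -> R).
Hypotheses (beta0 : 0 < beta) (c0 : 0 < c).
Hypothesis p01 : forall r, 0 <= p r <= 1.
Hypothesis p_tail : asymp_equiv (fun t => - ln (p t)) (fun t => c * t `^ beta).
Hypothesis F_lower : forall t r, 0 < t -> 0 < r ->
  p r * expR (- (pi ^+ 2 * t / (8 * r ^+ 2))) <= F t.
Hypothesis F_upper : forall t kappa (x : nat -> R) n, 0 < t -> 0 < kappa < 1 ->
  x 0 = 0 -> (forall j, 0 < x j.+1) ->
  F t <= \sum_(j < n) (p (x j) *
    (expR (- (kappa ^+ 2 * pi ^+ 2 * t / (8 * x j.+1 ^+ 2))) / cos (kappa * (pi / 2))))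
  + p (x n).

Let gamma := beta / (2 + beta).
(** Radius scale on which [r ^ beta] and [t / r ^ 2] both grow like [t ^ gamma]. *)
Let scale t : R := t `^ (2 + beta)^-1.
Let K := cost beta c (opt_radius beta c).

Let K0 : 0 < K. Proof. exact: cost_opt_gt0. Qed.

Let b2 : 0 < 2 + beta. Proof. by rewrite addr_gt0. Qed.

Let gamma0 : 0 < gamma. Proof. exact: divr_gt0. Qed.

Let scale_beta x t : 0 <= x -> 0 < t -> (x * scale t) `^ beta = x `^ beta * t `^ gamma.
Proof.
by move=> x0 t0; rewrite powRM ?powR_ge0// -powRrM [_^-1 * _]mulrC.
Qed.

Let scale_square q x t : 0 < x -> 0 < t ->
  q * t / (8 * (x * scale t) ^+ 2) = q / (8 * x ^+ 2) * t `^ gamma.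
Proof.
move=> x0 t0.
have : t `^ gamma * scale t ^+ 2 = t.
  rewrite -powR_mulrn ?powR_ge0// -powRrM -powRD ?(gt_eqF t0) ?implybT//.
  rewrite (_ : gamma + _ = 1) ?powRr1 ?(ltW t0)//.
  by rewrite /gamma; field; rewrite gt_eqF.
have s0 : 0 < scale t by exact: powR_gt0.
move: s0; set s := scale t; set g := t `^ gamma => s0 <-.
by field; rewrite !gt_eqF.
Qed.

Let near_scale x y : 0 < x -> \forall t \near +oo, y < x * scale t.
Proof.
move=> x0; near=> t.
have h : (`|y| + 1) / x <= scale t.
  by near: t; apply: near_powR_ge; rewrite invr_gt0.
have : `|y| + 1 <= x * scale t by rewrite mulrC -ler_pdivrMr.
by have := ler_norm y; lra.
Unshelve. all: by end_near. Qed.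

Let tail_bounds e : 0 < e < 1 -> exists M, forall r, M < r ->
  expR (- ((1 + e) * (c * r `^ beta))) <= p r <=
    expR (- ((1 - e) * (c * r `^ beta))).
Proof.
move=> e01.
have [M [_ h]] := asymp_equiv_tail_bounds p beta c e beta0 c0 e01 p_tail.
by exists M.
Qed.

(** Uses the single radius [opt_radius * scale t]. *)
Let mixed_lower e : 0 < e < 1 ->
  \forall t \near +oo, expR (- ((1 + e) * K * t `^ gamma)) <= F t.
Proof.
move=> e01; have [M hM] := tail_bounds e e01; move: (e01) => /andP[e0 e1].
have xs0 := opt_radius_gt0 beta c beta0 c0.
near=> t.
have t0 : 0 < t by near: t; exact: nbhs_pinfty_gt.
have tM : M < opt_radius beta c * scale t by near: t; exact: near_scale.
have /andP[h _] := hM _ tM.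
have s0 : 0 < opt_radius beta c * scale t by rewrite mulr_gt0// powR_gt0.
apply: le_trans (F_lower _ _ t0 s0).
apply: le_trans (ler_wpM2r (expR_ge0 _) h); rewrite -expRD ler_expR.
rewrite (scale_square _ _ _ xs0 t0) scale_beta// ?(ltW xs0)//.
rewrite /K /cost; set A := c * _ `^ _; set B := pi ^+ 2 / _; set g := t `^ gamma.
have B0 : 0 <= B by rewrite divr_ge0 ?sqr_ge0// mulr_ge0// sqr_ge0.
have g0 : 0 <= g by exact: powR_ge0.
have -> : c * (opt_radius beta c `^ beta * g) = A * g by rewrite mulrA.
have := mulr_ge0 (ltW e0) (mulr_ge0 B0 g0); lra.
Unshelve. all: by end_near. Qed.

(** Two factors [1 - e] are lost in each cell: to the tail estimate and the grid ratio in the term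
    of [xi], to [kappa = 1 - e] squared in the exit term. The third absorbs the constant [D]. *)
Let mixed_upper e : 0 < e < 1 ->
  \forall t \near +oo, F t <= expR (- ((1 - e) ^+ 3 * K * t `^ gamma)).
Proof.
move=> e01; have [M hM] := tail_bounds e e01; move: (e01) => /andP[e0 e1].
have pi0 := @pi_gt0 R.
have e'0 : 0 < 1 - e by rewrite subr_gt0.
have k01 : 0 < 1 - e < 1 by rewrite e'0/=; lra.
pose x1 := Num.sqrt (pi ^+ 2 / (8 * K)).
have x1K : 0 < pi ^+ 2 / (8 * K) by rewrite divr_gt0 ?exprn_gt0// mulr_gt0.
have x1_gt0 : 0 < x1 by rewrite sqrtr_gt0.
have x1E : pi ^+ 2 / (8 * x1 ^+ 2) = K.
  rewrite sqr_sqrtr ?(ltW x1K)//; set P := pi ^+ 2.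
  by field; rewrite (gt_eqF K0) gt_eqF// exprn_gt0.
(* Geometric grid of ratio [rho]: [x `^ beta] grows by [1 / (1 - e)] per cell,
   and the first cell [x <= x1] already costs [K] through the exit time. *)
pose rho := (1 - e) `^ (- beta^-1).
have rho_beta : rho `^ beta = (1 - e)^-1.
  by rewrite -powRrM mulNr mulVf ?gt_eqF// powR_inv1// ltW.
have rho0 : 0 < rho by exact: powR_gt0.
have rho1 : 1 <= rho.
  rewrite /rho powRN invr_ge1 ?powR_gt0 ?unitfE ?gt_eqF ?powR_gt0//.
  rewrite -[leRHS](powRr0 (1 - e)) ger_powR ?invr_ge0 ?(ltW beta0)//.
  by rewrite e'0/=; lra.
pose y j := x1 * rho ^+ j.
have y0 j : 0 < y j by rewrite mulr_gt0// exprn_gt0.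
have y_ge j : x1 <= y j by rewrite ler_pMr// exprn_ege1.
have y_step j : y j `^ beta = (1 - e) * y j.+1 `^ beta.
  rewrite [y j.+1](_ : _ = y j * rho); last by rewrite /y exprSr mulrA.
  rewrite [in RHS]powRM ?(ltW (y0 j)) ?(ltW rho0)// rho_beta mulrCA divff ?mulr1//.
  by rewrite gt_eqF.
(* The grid stops where the tail of [xi] alone already costs [K]. *)
have [N hN] : exists N, K <= c * y N `^ beta.
  have yN n : y n `^ beta * (1 - e) ^+ n = x1 `^ beta.
    elim: n => [|n IH]; first by rewrite /y expr0 !mulr1.
    by rewrite exprS mulrA [_ * (1 - e)]mulrC -y_step.
  have q0 : 0 < c * x1 `^ beta / K by rewrite divr_gt0// mulr_gt0// powR_gt0.
  have : \forall n \near \oo, (1 - e) ^+ n < c * x1 `^ beta / K.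
    by apply: (cvgr_lt (0 : R)) => //; apply: cvg_expr; rewrite gtr0_norm//; lra.
  move=> [n _ /(_ n (leqnn n))] /=.
  rewrite ltr_pdivlMr// => h; exists n.
  rewrite -(ler_pM2l (exprn_gt0 n e'0)) (le_trans (ltW h))//.
  by rewrite -(yN n) mulrA mulrC [c * _]mulrC.
(* [N.+1] cells, each with the factor [1 / cos], plus the final tail. *)
pose D := N.+1%:R / cos ((1 - e) * (pi / 2)) + 1.
have cos0 : 0 < cos ((1 - e) * (pi / 2)) by rewrite cos_gt0_pihalf//; nra.
have D0 : 0 < D by rewrite addr_gt0// divr_gt0.
near=> t.
have t0 : 0 < t by near: t; exact: nbhs_pinfty_gt.
have tM : M < x1 * scale t by near: t; exact: near_scale.
(* Ensures [D <= expR (e * (1 - e) ^+ 2 * K * g)], and [e * (1 - e) ^+ 2] is the difference of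
   [(1 - e) ^+ 2] and [(1 - e) ^+ 3]. *)
have tD : ln D / (e * (1 - e) ^+ 2 * K) <= t `^ gamma.
  by near: t; exact: near_powR_ge.
have s0 : 0 < scale t by exact: powR_gt0.
have g0 : 0 < t `^ gamma by exact: powR_gt0.
set g := t `^ gamma in tD g0 *.
have p_y j : p (y j * scale t) <= expR (- ((1 - e) * (c * y j `^ beta) * g)).
  have yM : M < y j * scale t by apply: lt_le_trans tM _; rewrite ler_pM2r.
  have /andP[_ h] := hM _ yM; apply: (le_trans h).
  by rewrite ler_expR scale_beta ?(ltW (y0 j))// -/g !mulrA.
pose E := expR (- ((1 - e) ^+ 2 * K * g)).
(* The indices are shifted by one: [x 0 = 0] and [x j.+1] is the scaled [y j], so the last threshold
   [x N.+1] is [y N * scale t]. *)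
pose x j := if j is j'.+1 then y j' * scale t else 0.
have x_gt0 j : 0 < x j.+1 by rewrite mulr_gt0.
have DE : D * E <= expR (- ((1 - e) ^+ 3 * K * g)).
  rewrite -[D]lnK ?posrE// -expRD ler_expR.
  have : ln D <= e * (1 - e) ^+ 2 * K * g.
    by rewrite [leRHS]mulrC -ler_pdivrMr// !mulr_gt0// exprn_gt0.
  lra.
apply: le_trans DE.
apply: (le_trans (F_upper t (1 - e) x N.+1 t0 k01 erefl x_gt0)).
rewrite /D [leRHS](mulrDl _ 1 E) [1 * E]mul1r lerD//; last first.
  apply: (le_trans (p_y N)); rewrite ler_expR lerN2 ler_pM2r//.
  rewrite expr2 -mulrA ler_pM2l// (le_trans _ hN)//.
  by rewrite ler_piMl ?(ltW K0)//; lra.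
set C := cos _ in cos0 *.
have -> : N.+1%:R / C * E = \sum_(j < N.+1) E / C.
  by rewrite sumr_const card_ord -[RHS]mulr_natl -mulrA [C^-1 * _]mulrC.
apply: ler_sum => j _; rewrite mulrA ler_pM2r ?invr_gt0//.
rewrite [x j.+1]/(y j * scale t) (scale_square _ _ _ (y0 j) t0) -/g.
(* In the first cell the tail is bounded by [1] and the exit term suffices. In the others, [y_step]
   moves the tail term to the right endpoint, where [cost_ge] applies. *)
case: j => -[|j] /= _.
  rewrite -[leRHS]mul1r ler_pM ?expR_ge0//; try by have /andP[] := p01 0.
  by rewrite ler_expR lerN2 ler_pM2r// /y expr0 mulr1 -mulrA x1E.
apply: (le_trans (ler_wpM2r (expR_ge0 _) (p_y j))).
rewrite -expRD ler_expR -opprD lerN2 -mulrDl ler_pM2r// y_step.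
have := cost_ge beta c beta0 c0 _ (y0 j.+1); rewrite -/K /cost.
move=> h; apply: le_trans (ler_wpM2l (sqr_ge0 (1 - e)) h) _.
rewrite le_eqVlt; apply/orP; left; apply/eqP.
set P := pi ^+ 2; set Y := y j.+1 ^+ 2; ring.
Unshelve. all: by end_near. Qed.

Lemma mixed_tail_asymp :
  asymp_equiv (fun t => - ln (F t)) (fun t => K * t `^ gamma).
Proof.
apply/cvgrPdist_le => e e0.
(* Then [(1 - d) ^+ 3 >= 1 - 3 * d >= 1 - e] and [1 + d <= 1 + e]. *)
pose d := Num.min (e / 3) 2^-1.
have d0 : 0 < d by rewrite lt_min invr_gt0 ltr0n andbT divr_gt0.
have d1 : d <= 2^-1 by rewrite ge_min lexx orbT.
have de : d <= e / 3 by rewrite ge_min lexx.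
have d01 : 0 < d < 1 by rewrite d0/=; lra.
near=> t.
have t0 : 0 < t by near: t; exact: nbhs_pinfty_gt.
have h1 : expR (- ((1 + d) * K * t `^ gamma)) <= F t.
  by near: t; exact: mixed_lower.
have h2 : F t <= expR (- ((1 - d) ^+ 3 * K * t `^ gamma)).
  by near: t; exact: mixed_upper.
have F0 : 0 < F t by apply: lt_le_trans h1; exact: expR_gt0.
have g0 : 0 < K * t `^ gamma by rewrite mulr_gt0// powR_gt0.
rewrite -[F t]lnK ?posrE// !ler_expR in h1 h2.
set g := K * _ in g0 *; rewrite -!mulrA -/g in h1 h2.
have h3 : 1 - 3 * d <= (1 - d) ^+ 3.
  have -> : (1 - d) ^+ 3 = 1 - 3 * d + d ^+ 2 * (3 - d) by ring.
  by rewrite lerDl mulr_ge0 ?sqr_ge0//; lra.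
have h4 : (1 - 3 * d) * g <= (1 - d) ^+ 3 * g by rewrite ler_pM2r.
rewrite ler_distlC ler_pdivlMr// ler_pdivrMr//; apply/andP; split.
  have : (1 - e) * g <= (1 - 3 * d) * g by rewrite ler_pM2r//; lra.
  lra.
have : (1 + d) * g <= (1 + e) * g by rewrite ler_pM2r//; lra.
lra.
Unshelve. all: by end_near. Qed.

End mixed_tail.

Theorem theorem4p1 (R : realType) (d : measure_display) (T : measurableType d)
  (P : probability T R) (beta c : R) (xi : T -> R) (Y : R -> T -> R) :
  0 < beta -> 0 < c ->
  measurable_fun [set: T] xi -> (forall w, 0 < xi w) ->
  asymp_equiv (fun t => - ln (fine (P [set w | t < xi w]))) (fun t => c * t `^ beta) ->
  brownian_motion P Y ->
  independent_sigma P (sigma_rv xi) (sigma_process Y) ->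
  asymp_equiv (fun t => - ln (fine (P [set w | (t%:E < exit_time Y xi w)%E])))
    (fun t => 2 `^ (- (2 * beta) / (2 + beta)) * ((2 + beta) / 2)
              * c `^ (2 / (2 + beta)) * beta `^ (- beta / (2 + beta))
              * pi `^ (2 * beta / (2 + beta)) * t `^ (beta / (2 + beta))).
Proof.
move=> beta0 c0 mxi xi0 xi_tail BM indep; rewrite -cost_optE//.
apply: (mixed_tail_asymp beta c (fun t => fine (P [set w | t < xi w]))) => //.
- move=> r; rewrite fine_ge0//=.
  have mr := measurable_gt xi r mxi.
  by rewrite -lee_fin fineK ?fin_num_measure// probability_le1.
- by move=> t r t0 r0; exact: exit_tail_lower.
- by move=> t kappa x n t0; exact: exit_tail_upper.
Qed.
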